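(* Let $\Bbbk$ be an algebraically closed field of characteristic $0$, let $X$ be an irreducible smooth affine algebraic variety over $\Bbbk$, $A=\Bbbk[X]$ and $\mathcal{V}=\mathrm{Der}_{\Bbbk}(A)$. If $M$ is a finite $A\mathcal{V}$-module and $f\in A$, $f\neq 0$, then $M_f=A_f\otimes_A M$ is a finite $A_f\mathcal{V}_f$-module, where the action of $A_f$ is given by left multiplication and \[ \left(\frac{\eta}{f^k}\right)m=\sum_{p=0}^{\infty}\frac{1}{f^{k(p+1)}}\,\Omega_p(f^k,\eta)\,m \] for each $\eta\in\mathcal{V}$, each integer $k\ge 0$ and each $m\in M_f$ (the sum having only finitely many nonzero terms).
   Context: An $A\mathcal{V}$-module is a $\Bbbk$-vector space $M$ that is both an $A$-module and a module over the Lie algebra $\mathcal{V}$, such that $\eta\cdot(g\cdot m)=\eta(g)\cdot m+g\cdot(\eta\cdot m)$ for all $\eta\in\mathcal{V}$, $g\in A$, $m\in M$; equivalently it is a module over the smash product $A\#U(\mathcal{V})$, with $(g\#u)m=g\cdot(u\cdot m)$. It is finite if it is finitely generated as an $A$-module. $A_f$ is the localization of $A$ at $\{f^k\mid k\ge0\}$ and $\mathcal{V}_f=\mathrm{Der}(A)_f\cong\mathrm{Der}(A_f)$. An $A_f\mathcal{V}_f$-module is defined in the same way with $A_f,\mathcal{V}_f$ in place of $A,\mathcal{V}$, and is finite if finitely generated over $A_f$. For $g\in A$, $\eta\in\mathcal{V}$ and $p\ge1$, $\Omega_p(g,\eta)=\sum_{k=0}^p(-1)^k\binom pk g^{p-k}\#g^k\eta\in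 A\#U(\mathcal{V})$, and $\Omega_0(g,\eta)=1\#\eta$. For $p\ge 1$, $\Omega_p(g,\eta)$ acts on $M$ by an $A$-linear map, and it acts on $M_f$ by the $A_f$-linear extension of that map. The element $\Omega_0(g,\eta)=1\#\eta$, $\eta\in\mathcal{V}$, acts on $M_f$ by the quotient rule $(1\#\eta)\left(\frac{m}{f^j}\right)=-\frac{j\,\eta(f)m}{f^{j+1}}+\frac{1}{f^j}(\eta m)$ for $m\in M$, $j\ge 0$. *)

(* Defs.v *)
From HB Require Import structures.
From mathcomp Require Import all_boot all_algebra.
From mathcomp Require Import generic_quotient.
From mathcomp Require Import boolp classical_sets functions.
From mathcomp Require Import mpoly.
From mathcomp Require Import ring.

Set Implicit Arguments.
Unset Strict Implicit.
Unset Printing Implicit Defensive.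

Import GRing.Theory.
Local Open Scope ring_scope.
Local Open Scope quotient_scope.
Local Open Scope classical_set_scope.

Section Variety.
Variables (K : fieldType) (n : nat).
Implicit Types X Y Z : set ('I_n -> K).

Definition zariski_closed X : Prop :=
  exists S : set {mpoly K[n]}, X = [set x | forall p, S p -> p.@[x] = 0].

Definition vanishing_ideal X : set {mpoly K[n]} :=
  [set p | forall x, X x -> p.@[x] = 0].

(* In particular an irreducible set is nonempty. *)
Definition irreducible_set X : Prop :=
  X !=set0 /\
  forall Y Z, zariski_closed Y -> zariski_closed Z ->
    X `<=` Y `|` Z -> X `<=` Y \/ X `<=` Z.

Definition irreducible_chain X (d : nat) (C : nat -> set ('I_n -> K)) : Prop :=
  (forall i, (i <= d)%N ->
     [/\ zariski_closed (C i), irreducible_set (C i) & C i `<=` X]) /\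
  (forall i, (i < d)%N -> C i `<` C i.+1).

Definition has_dim X (d : nat) : Prop :=
  (exists C, irreducible_chain X d C) /\
  (forall e C, irreducible_chain X e C -> (e <= d)%N).

Definition tangent_vector X (x : 'I_n -> K) (v : 'rV[K]_n) : Prop :=
  forall p, vanishing_ideal X p -> \sum_(j < n) (mderiv j p).@[x] * v 0 j = 0.

(* Stated for irreducible [X], where the local dimension at every point is the
   dimension of [X]. *)
Definition smooth X : Prop :=
  forall x, X x -> exists T : {vspace 'rV[K]_n},
    (forall v, v \in T <-> tangent_vector X x v) /\ has_dim X (\dim T).

(* [phi] presents [A] as K[x_1, ..., x_n] / I(X). *)
Definition is_coordinate_ring X (A : comAlgType K)
    (phi : {lrmorphism {mpoly K[n]} -> A}) : Prop :=
  (forall a, exists p, phi p = a) /\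
  (forall p, phi p = 0 <-> vanishing_ideal X p).

End Variety.

(* [B] is a K-algebra via [iota]; it need not be nontrivial, unlike instances
   of [algType K]. *)
Section Derivation.
Variables (K : pzRingType) (B : comPzRingType) (iota : {rmorphism K -> B}).

Definition is_derivation (d : B -> B) : Prop :=
  [/\ forall a b, d (a + b) = d a + d b,
      forall c a, d (iota c * a) = iota c * d a
    & forall a b, d (a * b) = d a * b + a * d b].

Definition derivation_pred : {pred (B -> B^o)} := fun d => `[< is_derivation d >].

Fact derivation_submod_closed : submod_closed derivation_pred.
Proof.
split; first by apply/asboolP; split=> *; rewrite /0/= ?mulr0 ?mul0r ?addr0.
move=> a d e /asboolP[dD dZ dM] /asboolP[eD eZ eM].
by apply/asboolP; split=> *; rewrite !fctE /GRing.scale/= ?(dD, dZ, dM, eD, eZ, eM); ring.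
Qed.

HB.instance Definition _ :=
  GRing.isSubmodClosed.Build B (B -> B^o) derivation_pred derivation_submod_closed.

Record der := Der { der_fun : B -> B^o; _ : der_fun \in derivation_pred }.

HB.instance Definition _ := [isSub for der_fun].
HB.instance Definition _ := [Choice of der by <:].
HB.instance Definition _ := [SubChoice_isSubLmodule of der by <:].

Definition der_app (d : der) : B -> B := der_fun d.
Coercion der_app : der >-> Funclass.

Lemma derP (d : der) : is_derivation d.
Proof. by case: d => d /= /asboolP. Qed.

Lemma der_eq (d e : der) : (forall a, d a = e a) -> d = e.
Proof. by move=> de; apply/val_inj/funext. Qed.

Fact bracket_proof (d e : der) :
  (fun a => d (e a) - e (d a) : B^o) \in derivation_pred.
Proof.
have [dD dZ dM] := derP d; have [eD eZ eM] := derP e.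
by apply/asboolP; split=> *; rewrite ?(dD, dZ, dM, eD, eZ, eM); ring.
Qed.

Definition bracket (d e : der) : der := Der (bracket_proof d e).

(* [act] makes the B-module [M] an AV-module, for the pair (B, Der_K(B)); the
   K-vector space structure of [M] is the one underlying its B-module
   structure. *)
Record AV_module (M : lmodType B) (act : der -> M -> M) : Prop := {
  AV_Dl : forall d e m, act (d + e) m = act d m + act e m;
  AV_Zl : forall c d m, act (iota c *: d) m = iota c *: act d m;
  AV_Dr : forall d m m', act d (m + m') = act d m + act d m';
  AV_Zr : forall c d m, act d (iota c *: m) = iota c *: act d m;
  AV_bracket : forall d e m,
    act (bracket d e) m = act d (act e m) - act e (act d m);
  AV_leibniz : forall d a m, act d (a *: m) = d a *: m + a *: act d m
}.

(* The action of the element Omega_p(g, d) of the smash product B # U(Der B),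
   where (b # u) m = b (u m). *)
Definition Omega (M : lmodType B) (act : der -> M -> M) (p : nat) (g : B)
    (d : der) (m : M) : M :=
  \sum_(k < p.+1)
    ((-1) ^+ k * 'C(p, k)%:R * g ^+ (p - k)) *: act (g ^+ k *: d) m.

Lemma Omega0 (M : lmodType B) (act : der -> M -> M) g d m :
  Omega act 0 g d m = act d m.
Proof. by rewrite /Omega big_ord1 /= !expr0 bin0 !mulr1 !scale1r. Qed.

End Derivation.

Definition finitely_generated (B : pzRingType) (M : lmodType B) : Prop :=
  exists (r : nat) (e : 'I_r -> M),
    forall m, exists c : 'I_r -> B, m = \sum_(i < r) c i *: e i.

Fact leibnizX (A : comPzRingType) (f : A) (i : nat) (d : A -> A) :
  (forall a b, d (a * b) = d a * b + a * d b) ->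
  f * d (f ^+ i) = (d f *+ i) * f ^+ i.
Proof.
move=> dM; elim: i => [|i IH].
  have /eqP : d (1 * 1) = d 1 + d 1 by rewrite dM mulr1 mul1r.
  by rewrite mulr1 eq_sym -subr_eq0 addrK => /eqP ->; rewrite mulr0 mulr0n mul0r.
by rewrite exprS dM mulrDr [f * (f * _)]mulrCA IH mulrSr; ring.
Qed.

Section LocModule.
Variables (A : comPzRingType) (f : A) (M : lmodType A).
Implicit Types m n : M.

Let fX i j m : f ^+ i *: (f ^+ j *: m) = f ^+ (i + j) *: m.
Proof. by rewrite scalerA exprD. Qed.

Let fXshift k i j m n :
  f ^+ i *: m = f ^+ j *: n -> f ^+ (k + i) *: m = f ^+ (k + j) *: n.
Proof. by move=> e; rewrite -!fX e. Qed.

Definition loc_rel (x y : M * nat) : bool :=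
  `[< exists k, f ^+ (k + y.2) *: x.1 = f ^+ (k + x.2) *: y.1 >].

Fact loc_rel_equiv : equiv_class_of loc_rel.
Proof.
split.
- by move=> x; apply/asboolP; exists 0%N.
- by move=> x y; apply/asboolP/asboolP=> -[k e]; exists k.
move=> y x z /asboolP[k e] /asboolP[l e']; apply/asboolP.
exists (k + l + y.2)%N.
have -> : (k + l + y.2 + z.2 = (l + z.2) + (k + y.2))%N by ring.
rewrite (fXshift _ e).
have -> : (l + z.2 + (k + x.2) = (k + x.2) + (l + z.2))%N by ring.
by rewrite (fXshift _ e'); congr (f ^+ _ *: _); ring.
Qed.

Canonical loc_equiv : equiv_rel (M * nat)%type := EquivRelPack loc_rel_equiv.

(* The localized module M_f; [frac m j] is m / f^j. *)
Definition loc : Type := {eq_quot loc_equiv}.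

HB.instance Definition _ := Choice.on loc.

Definition frac m (j : nat) : loc := \pi_({eq_quot loc_equiv}) (m, j).

Definition loc_rep (x : loc) : M * nat := repr (x : {eq_quot loc_equiv}).

Lemma fracP m i n j :
  frac m i = frac n j <-> exists k, f ^+ (k + j) *: m = f ^+ (k + i) *: n.
Proof.
rewrite /frac; split.
  by move=> /eqP; rewrite eqmodE => /asboolP.
by move=> e; apply/eqP; rewrite eqmodE; apply/asboolP.
Qed.

Lemma frac_rep x : frac (loc_rep x).1 (loc_rep x).2 = x.
Proof. by rewrite /frac -surjective_pairing; apply: reprK. Qed.

Lemma loc_repP m j : exists k,
  f ^+ (k + (loc_rep (frac m j)).2) *: m = f ^+ (k + j) *: (loc_rep (frac m j)).1.
Proof. by apply/fracP; rewrite frac_rep. Qed.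

Lemma fracW (P : loc -> Prop) : (forall m j, P (frac m j)) -> forall x, P x.
Proof. by move=> Pf x; rewrite -(frac_rep x). Qed.

Lemma frac_shift k m j : frac (f ^+ k *: m) (k + j) = frac m j.
Proof. by apply/fracP; exists 0%N; rewrite fX; congr (f ^+ _ *: _); ring. Qed.

Definition loc_add (x y : loc) : loc :=
  frac (f ^+ (loc_rep y).2 *: (loc_rep x).1 + f ^+ (loc_rep x).2 *: (loc_rep y).1)
       ((loc_rep x).2 + (loc_rep y).2).
Definition loc_opp (x : loc) : loc := frac (- (loc_rep x).1) (loc_rep x).2.

Fact loc_addE m i n j :
  loc_add (frac m i) (frac n j) = frac (f ^+ j *: m + f ^+ i *: n) (i + j).
Proof.
rewrite /loc_add.
have [k] := loc_repP m i; have [l] := loc_repP n j.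
case: (loc_rep (frac m i)) => m' i'; case: (loc_rep (frac n j)) => n' j' /= e e'.
apply/esym/fracP; exists (k + l)%N; rewrite !scalerDr !fX; congr (_ + _).
  have -> : (k + l + (i' + j') + j = (l + j' + j) + (k + i'))%N by ring.
  by rewrite (fXshift _ e'); congr (f ^+ _ *: _); ring.
have -> : (k + l + (i' + j') + i = (k + i' + i) + (l + j'))%N by ring.
by rewrite (fXshift _ e); congr (f ^+ _ *: _); ring.
Qed.

Fact loc_oppE m i : loc_opp (frac m i) = frac (- m) i.
Proof.
rewrite /loc_opp; have [k e] := loc_repP m i.
by apply/esym/fracP; exists k; rewrite !scalerN e.
Qed.

Fact loc_addA : associative loc_add.
Proof.
elim/fracW=> m i; elim/fracW=> n j; elim/fracW=> p k; rewrite !loc_addE.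
rewrite !scalerDr !fX addrA addnA.
by congr (frac (_ + _ + _) _); congr (f ^+ _ *: _); ring.
Qed.

Fact loc_addC : commutative loc_add.
Proof.
by elim/fracW=> m i; elim/fracW=> n j; rewrite !loc_addE addrC addnC.
Qed.

Fact loc_add0 : left_id (frac 0 0) loc_add.
Proof.
by elim/fracW=> m i; rewrite loc_addE scaler0 add0r expr0 scale1r.
Qed.

Fact loc_addN : left_inverse (frac 0 0) loc_opp loc_add.
Proof.
elim/fracW=> m i; rewrite loc_oppE loc_addE scalerN addNr.
by apply/fracP; exists 0%N; rewrite !scaler0.
Qed.

HB.instance Definition _ :=
  GRing.isZmodule.Build loc loc_addA loc_addC loc_add0 loc_addN.

Lemma fracD m i n j :
  frac m i + frac n j = frac (f ^+ j *: m + f ^+ i *: n) (i + j).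
Proof. exact: loc_addE. Qed.

Lemma fracN m i : - frac m i = frac (- m) i.
Proof. exact: loc_oppE. Qed.

Lemma frac0 i : frac 0 i = 0.
Proof. by apply/fracP; exists 0%N; rewrite !scaler0. Qed.

Lemma fracDs m n i : frac (m + n) i = frac m i + frac n i.
Proof. by rewrite fracD -scalerDr frac_shift. Qed.

(* The A_f-linear extension of an A-linear map, and the quotient rule, see
   [loc_mapE] and [quot_ruleE]. *)
Definition loc_map (T : M -> M) (x : loc) : loc :=
  frac (T (loc_rep x).1) (loc_rep x).2.

Definition quot_rule (d : A -> A) (D : M -> M) (x : loc) : loc :=
  - frac ((d f *+ (loc_rep x).2) *: (loc_rep x).1) (loc_rep x).2.+1
  + frac (D (loc_rep x).1) (loc_rep x).2.

Lemma loc_mapE (T : M -> M) m j :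
  (forall a n, T (a *: n) = a *: T n) -> loc_map T (frac m j) = frac (T m) j.
Proof.
move=> TZ; rewrite /loc_map; have [k e] := loc_repP m j.
by apply/esym/fracP; exists k; rewrite -!TZ e.
Qed.

Lemma quot_ruleE (d : A -> A) (D : M -> M) m j :
  (forall a b, d (a * b) = d a * b + a * d b) ->
  (forall a n, D (a *: n) = d a *: n + a *: D n) ->
  quot_rule d D (frac m j) = - frac ((d f *+ j) *: m) j.+1 + frac (D m) j.
Proof.
move=> dM DZ; 
set N := fun m j => f *: D m - (d f *+ j) *: m.
have NE n i : - frac ((d f *+ i) *: n) i.+1 + frac (D n) i = frac (N n i) i.+1.
  by rewrite -(frac_shift 1 (D n)) expr1 add1n fracN -fracDs addrC.
rewrite /quot_rule !NE; have [k] := loc_repP m j.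
case: (loc_rep (frac m j)) => m' j' /= e.
have dX i := leibnizX f i dM.
have NX a n i : f ^+ a *: N n i
    = f *: D (f ^+ a *: n) - (d f *+ (a + i)) *: (f ^+ a *: n).
  rewrite /N DZ scalerDr scalerN scalerDr !scalerA dX mulrnDr.
  rewrite mulrDl scalerDl [f ^+ a * f]mulrC [f ^+ a * _]mulrC.
  by rewrite opprD addrA [_ + _ *: D n]addrC addrK.
apply/esym/fracP; exists k; rewrite !addnS !exprS -!scalerA !NX e.
by congr (_ *: (_ - _ *+ _ *: _)); ring.
Qed.

End LocModule.

Section LocRing.
Variables (A : comPzRingType) (f : A).

(* The localized ring A_f; [frac f a j] is a / f^j. *)
Definition loc_ring : Type := loc f A^o.

HB.instance Definition _ := GRing.Zmodule.on loc_ring.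

Definition rfrac (a : A) (j : nat) : loc_ring := frac f (a : A^o) j.

Section Scale.
Variable M : lmodType A.

Definition loc_scale (s : loc_ring) (x : loc f M) : loc f M :=
  frac f (((loc_rep s).1 : A) *: (loc_rep x).1) ((loc_rep s).2 + (loc_rep x).2).

Fact loc_scaleE a i m j :
  loc_scale (rfrac a i) (frac f m j) = frac f (a *: m) (i + j).
Proof.
rewrite /loc_scale.
have [k] := loc_repP f (a : A^o) i; have [l] := loc_repP f m j.
rewrite -/(rfrac a i); case: (loc_rep (rfrac a i)) => a' i' /=.
case: (loc_rep (frac f m j)) => m' j' /= e e'.
have {}e' : f ^+ (k + i') * a = f ^+ (k + i) * a' := e'.
have split b c (u : A) n :
    f ^+ (k + l + (b + c)) *: (u *: n) = (f ^+ (k + b) * u) *: (f ^+ (l + c) *: n).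
  by rewrite addnACA exprD !scalerA; congr (_ *: _); ring.
by apply/esym/fracP; exists (k + l)%N; rewrite !split e e'.
Qed.

End Scale.

Definition loc_one : loc_ring := rfrac 1 0.
Definition loc_mul (s t : loc_ring) : loc_ring := @loc_scale A^o s t.

Fact loc_mulE a i b j : loc_mul (rfrac a i) (rfrac b j) = rfrac (a * b) (i + j).
Proof. exact: loc_scaleE. Qed.

Lemma rfracW (P : loc_ring -> Prop) : (forall a j, P (rfrac a j)) -> forall s, P s.
Proof. exact: (@fracW A f A^o). Qed.

Lemma rfracD a i b j : rfrac a i + rfrac b j = rfrac (f ^+ j * a + f ^+ i * b) (i + j).
Proof. exact: (@fracD A f A^o). Qed.

Lemma rfracDs a b i : rfrac (a + b) i = rfrac a i + rfrac b i.
Proof. exact: (@fracDs A f A^o). Qed.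

Lemma rfrac_shift k a j : rfrac (f ^+ k * a) (k + j) = rfrac a j.
Proof. exact: (@frac_shift A f A^o). Qed.

Fact loc_mulA : associative loc_mul.
Proof.
elim/rfracW=> a i; elim/rfracW=> b j; elim/rfracW=> c k.
by rewrite !loc_mulE mulrA addnA.
Qed.

Fact loc_mulC : commutative loc_mul.
Proof. by elim/rfracW=> a i; elim/rfracW=> b j; rewrite !loc_mulE mulrC addnC. Qed.

Fact loc_mul1 : left_id loc_one loc_mul.
Proof. by elim/rfracW=> a i; rewrite loc_mulE mul1r. Qed.

Fact loc_mulDl : left_distributive loc_mul +%R.
Proof.
elim/rfracW=> a i; elim/rfracW=> b j; elim/rfracW=> c k.
rewrite rfracD !loc_mulE rfracD -[RHS](rfrac_shift 0) expr0 mul1r add0n.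
rewrite -(rfrac_shift k); congr rfrac; last by ring.
by rewrite !exprD; ring.
Qed.

HB.instance Definition _ := GRing.Zmodule_isComPzRing.Build loc_ring
  loc_mulA loc_mulC loc_mul1 loc_mulDl.

Lemma rfracM a i b j : rfrac a i * rfrac b j = rfrac (a * b) (i + j).
Proof. exact: loc_mulE. Qed.

Definition loc_inj (a : A) : loc_ring := rfrac a 0.

Fact loc_inj_additive : zmod_morphism loc_inj.
Proof.
move=> a b; rewrite /loc_inj rfracDs; congr (_ + _).
by rewrite /rfrac -fracN.
Qed.

Fact loc_inj_multiplicative : monoid_morphism loc_inj.
Proof. by split=> // a b; rewrite /loc_inj rfracM. Qed.

HB.instance Definition _ := GRing.isZmodMorphism.Build A loc_ring loc_inj
  loc_inj_additive.
HB.instance Definition _ := GRing.isMonoidMorphism.Build A loc_ring loc_inj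
  loc_inj_multiplicative.

Section LocLmodule.
Variable M : lmodType A.

Fact loc_scaleA (s t : loc_ring) (x : loc f M) :
  loc_scale s (loc_scale t x) = loc_scale (s * t) x.
Proof.
elim/rfracW: s => a i; elim/rfracW: t => b j; elim/fracW: x => m k.
by rewrite rfracM !loc_scaleE scalerA addnA.
Qed.

Fact loc_scale1 : left_id (1 : loc_ring) (@loc_scale M).
Proof. by elim/fracW=> m j; rewrite loc_scaleE scale1r. Qed.

Fact loc_scaleDr : right_distributive (@loc_scale M) +%R.
Proof.
elim/rfracW=> a i; elim/fracW=> m j; elim/fracW=> n k.
rewrite fracD !loc_scaleE fracD -(frac_shift f i); congr frac; last by ring.
by rewrite !scalerDr !scalerA !exprD; congr (_ *: _ + _ *: _); ring.
Qed.

Fact loc_scaleDl (x : loc f M) : {morph (@loc_scale M)^~ x : s t / s + t}.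
Proof.
elim/rfracW=> a i; elim/rfracW=> b j; elim/fracW: x => m k.
rewrite rfracD !loc_scaleE fracD -(frac_shift f k); congr frac; last by ring.
by rewrite scalerDl !scalerDr !scalerA !exprD; congr (_ *: _ + _ *: _); ring.
Qed.

HB.instance Definition _ := GRing.Zmodule_isLmodule.Build loc_ring (loc f M)
  loc_scaleA loc_scale1 loc_scaleDr loc_scaleDl.

Lemma fracZ a i m j : rfrac a i *: frac f m j = frac f (a *: m) (i + j).
Proof. exact: loc_scaleE. Qed.

(* [loc f M] is A_f (x)_A M, with [frac f m j] for (1 / f^j) (x) m: it has the
   universal property of the extension of scalars. *)
Lemma loc_universal (N : lmodType loc_ring) (g : M -> N) :
  (forall m n, g (m + n) = g m + g n) ->
  (forall a m, g (a *: m) = loc_inj a *: g m) ->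
  exists! h : loc f M -> N,
    (forall s x y, h (s *: x + y) = s *: h x + h y) /\
    (forall m, h (frac f m 0) = g m).
Proof.
move=> gD gZ.
have VX k i : rfrac 1 (k + i) * loc_inj (f ^+ k) = rfrac 1 i.
  by rewrite /loc_inj rfracM addn0 mul1r -[in LHS](mulr1 (f ^+ k)) rfrac_shift.
pose h (x : loc f M) : N := rfrac 1 (loc_rep x).2 *: g (loc_rep x).1.
have hE m j : h (frac f m j) = rfrac 1 j *: g m.
  rewrite /h; have [k] := loc_repP f m j.
  case: (loc_rep _) => m' j' /= /(congr1 g); rewrite !gZ => e.
  rewrite -(VX (k + j)%N j') -scalerA -e scalerA -(VX (k + j')%N j) -scalerA.
  by rewrite scalerA; congr (rfrac _ _ * _ *: _); ring.
exists h; split; first split.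
- elim/rfracW=> a i; elim/fracW=> m j; elim/fracW=> n k.
  rewrite fracZ fracD !hE gD !gZ scalerDr !scalerA /loc_inj !rfracM; congr (_ *: _ + _ *: _).
    rewrite -[RHS](rfrac_shift k); congr rfrac; last by ring.
    by rewrite !(mul1r, mulr1).
  rewrite -[RHS](rfrac_shift (i + j)); congr rfrac; last by ring.
  by rewrite !(mul1r, mulr1).
- by move=> m; rewrite hE (_ : rfrac 1 0 = 1) ?scale1r.
move=> h' [h'L h'g]; apply/funext; elim/fracW=> m j; rewrite hE -h'g.
have h'0 : h' 0 = 0.
  by have /eqP := h'L 1 0 0; rewrite !scale1r addr0 eq_sym -subr_eq0 addrK => /eqP.
by rewrite -[LHS]addr0 -[X in _ + X]h'0 -h'L fracZ scale1r addn0 addr0.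
Qed.

End LocLmodule.
End LocRing.

Section LocAV.
Variables (K : pzRingType) (A : comPzRingType) (iota : {rmorphism K -> A}) (f : A).

Definition loc_iota : {rmorphism K -> loc_ring f} := loc_inj f \o iota.

Let quotE (eta : der iota) a i :
  @quot_rule A f A^o eta eta (rfrac f a i)
  = rfrac f (f * eta a - (eta f *+ i) * a) i.+1.
Proof.
have [etaD etaZ etaM] := derP eta; rewrite quot_ruleE //; last first.
rewrite -/(rfrac f (eta a) i) -(rfrac_shift f 1) expr1 add1n addrC.
by rewrite rfracDs /rfrac fracN.
Qed.

Fact loc_der_proof (eta : der iota) :
  (@quot_rule A f A^o eta eta : loc_ring f -> (loc_ring f)^o)
    \in derivation_pred loc_iota.
Proof.
have [etaD etaZ etaM] := derP eta.
have etaXM i a : f * (eta (f ^+ i) * a) = (eta f *+ i) * f ^+ i * a.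
  by rewrite mulrA leibnizX.
have rfE (a : A) i (b : A) j : f ^+ j * a = f ^+ i * b -> rfrac f a i = rfrac f b j.
  by move=> e; apply/(fracP f (a : A^o) i (b : A^o) j); exists 0%N.
apply/asboolP; split.
- elim/rfracW=> a i; elim/rfracW=> b j; rewrite rfracD !quotE rfracD.
  apply: rfE; rewrite etaD !etaM !mulrDr !etaXM.
  by rewrite !mulrnDr !(exprS, exprD); ring.
- move=> c; elim/rfracW=> a i; rewrite /loc_iota /= /loc_inj rfracM !quotE rfracM.
  by rewrite etaZ; apply: rfE; ring.
elim/rfracW=> a i; elim/rfracW=> b j; rewrite rfracM !quotE !rfracM rfracD.
by apply: rfE; rewrite etaM !(mulrnDr, exprS, exprD); ring.
Qed.

(* The extension of a derivation of A to A_f, so that [frac_der eta k] is the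
   element eta / f^k of Der(A_f) = Der(A)_f. *)
Definition loc_der (eta : der iota) : der loc_iota := Der (loc_der_proof eta).

Definition frac_der (eta : der iota) (k : nat) : der loc_iota :=
  rfrac f 1 k *: loc_der eta.

Variables (M : lmodType A) (act : der iota -> M -> M).

(* Computed on chosen representatives; when [act] is an AV-module action the
   result does not depend on them, see [Omega_loc0E] and [Omega_locE]. *)
Definition Omega_loc (p : nat) (g : A) (eta : der iota) : loc f M -> loc f M :=
  if p is 0 then quot_rule eta (act eta) else loc_map (Omega act p g eta).

Hypothesis actAV : AV_module act.

Lemma Omega_linear p g eta a m :
  Omega act p.+1 g eta (a *: m) = a *: Omega act p.+1 g eta m.
Proof.
rewrite /Omega scaler_sumr.
under eq_bigr => k _ do rewrite (AV_leibniz actAV) scalerDr !scalerA.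
rewrite big_split /= [X in X + _ = _](_ : _ = 0) ?add0r; last first.
  rewrite -scaler_suml.
  have -> : \sum_(k < p.+2) (-1) ^+ k * 'C(p.+1, k)%:R * g ^+ (p.+1 - k)
      * (g ^+ k *: eta) a = (1 - 1) ^+ p.+1 * (g ^+ p.+1 * eta a).
    rewrite exprBn mulr_suml; apply: eq_bigr => k _.
    rewrite (_ : (g ^+ k *: eta) a = g ^+ k * eta a) //.
    have -> : g ^+ p.+1 = g ^+ (p.+1 - k) * g ^+ k by rewrite -exprD subnK // -ltnS.
    by rewrite !expr1n !mulr1 mulr_natr !mulrA.
  by rewrite subrr expr0n mul0r scale0r.
by apply: eq_bigr => k _; rewrite !scalerA mulrC.
Qed.

Lemma Omega_loc0E g eta m j :
  Omega_loc 0 g eta (frac f m j)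
  = - frac f ((eta f *+ j) *: m) j.+1 + frac f (act eta m) j.
Proof.
have [etaD etaZ etaM] := derP eta.
by apply: quot_ruleE => // a n; apply: (AV_leibniz actAV).
Qed.

Lemma Omega_locE p g eta m j :
  Omega_loc p.+1 g eta (frac f m j) = frac f (Omega act p.+1 g eta m) j.
Proof. by apply: loc_mapE => a n; apply: Omega_linear. Qed.

End LocAV.

Lemma loc_derE (K : pzRingType) (A : comPzRingType) (iota : {rmorphism K -> A})
    (f a : A) (eta : der iota) :
  loc_der f eta (loc_inj f a) = loc_inj f (eta a).
Proof.
have [etaD etaZ etaM] := derP eta.
rewrite /= quot_ruleE // mulr0n scale0r.
by rewrite (@frac0 A f A^o) oppr0 add0r.
Qed.

Definition is_finite_sum (V : zmodType) (u : nat -> V) (s : V) : Prop :=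
  exists N, (forall p, (N <= p)%N -> u p = 0) /\ s = \sum_(p < N) u p.

(* Main.v *)
Require Import Defs.
From HB Require Import structures.
From mathcomp Require Import all_boot all_algebra.
From mathcomp Require Import boolp classical_sets functions.
From mathcomp Require Import mpoly.
From mathcomp Require Import ring zify.

(* The heart of the matter is that Omega_p(f, .) vanishes on M for large p.

   Smoothness makes A simple under its derivations: at a point x the Jacobian
   matrix, whose rank is the same everywhere, yields a derivation E acting as N on
   m^N / m^(N+1), so a stable ideal contained in m is contained in every m^N and
   vanishes by Krull's theorem; the Nullstellensatz concludes.  Hence M is
   torsion-free.

   Write X for f (x) 1 - 1 (x) f, so that Omega_p(f, eta) is the action of X^p eta.
   For p >= 1 these operators are A-linear, and they satisfy the commutation rules
   of vector fields in which eta acts on X as - eta(f).  Let mu(f) = h be nonzero.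
   Finite rank gives a polynomial g in X A[X] such that g mu acts as zero; brackets
   with multiples of g mu show that g^3 g' h^2 e mu acts as zero for all e, and
   brackets with X mu reduce g^3 g' to a power of X.  The elements b for which all
   X^p b eta with p large act as zero then form a nonzero stable ideal, which is A.

   Hence 1 (x) f^k is the invertible f^k (x) 1 minus a nilpotent operator on M_f,
   and the formula of the theorem is the geometric series for its inverse.  Two
   nilpotent expressions in elements of Der(A_f) that agree on Der(A) are equal,
   which reduces the axioms of an AV-module to the case of Der(A). *)

Set Implicit Arguments.
Unset Strict Implicit.
Unset Printing Implicit Defensive.

Import GRing.Theory.
Local Open Scope ring_scope.

(** * Noetherianity of polynomial rings and the Nullstellensatz *)

(** The obstacle is that [act] is not A-linear in the derivation: eta / f^k cannot act by dividing
    the action of eta by f^k, and a single finite sum needs a bound on p that depends on f^k alone,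
    not on eta or m. Such a bound must come from the finite rank of M, and rank arguments only see
    A-linear operators; this is why only polynomials in X without constant term are allowed.

    Simplicity of A is used three times: against torsion, to spread vanishing from multiples of one
    mu to all derivations, and when every derivation kills f. In that last case f is a scalar, and
    Omega_p(f, .) is zero for p >= 1 by K-linearity.

    The comparison of nilpotent expressions rests on one remark: if T(f D) = 0 for all D, then X
    acts on T as multiplication by f, a unit of A_f, so nilpotency gives T = 0. Allowing one more
    power of f in the denominator at each step, vanishing passes from Der(A) to Der(A_f). *)

Lemma exists_minimal (T : Type) (P : T -> Prop) (m : T -> nat) (x0 : T) :
  P x0 -> exists x, P x /\ forall y, P y -> (m x <= m y)%N.
Proof.
have [k] := ubnP (m x0); elim: k x0 => // k IH x0 xk Px0.
have [[y [Py yx]]|no] := pselect (exists y, P y /\ (m y < m x0)%N).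
  by apply: (IH y) => //; apply: leq_trans yx _.
exists x0; split=> // y Py; rewrite leqNgt; apply/negP => yx.
by apply: no; exists y.
Qed.

Record is_ideal (R : comPzRingType) (I : R -> Prop) : Prop := {
  ideal0 : I 0;
  idealD : forall x y, I x -> I y -> I (x + y);
  idealM : forall a x, I x -> I (a * x)
}.

Record is_prime_ideal (R : comPzRingType) (I : R -> Prop) : Prop := {
  prime_ideal : is_ideal I;
  prime1 : ~ I 1;
  primeM : forall a b, I (a * b) -> I a \/ I b
}.

Section Ideals.
Variables (R : comPzRingType) (I : R -> Prop).
Hypothesis Iid : is_ideal I.

Lemma idealN x : I x -> I (- x).
Proof. by move=> Ix; rewrite -mulN1r; apply: idealM. Qed.

Lemma idealB x y : I x -> I y -> I (x - y).
Proof. by move=> Ix Iy; apply: idealD => //; apply: idealN. Qed.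

Lemma ideal_sum (T : Type) (r : seq T) (F : T -> R) :
  (forall i, I (F i)) -> I (\sum_(i <- r) F i).
Proof.
move=> IF; elim/big_ind: _ => //; first exact: ideal0.
exact: idealD.
Qed.

End Ideals.

Lemma prime_ideal_exists (R : comPzRingType) (I : R -> Prop) :
  is_ideal I -> ~ I 1 ->
  exists P, is_prime_ideal P /\ forall x, I x -> P x.
Proof.
move=> Iid I1.
pose good (S : set R) :=
  (forall x, ~ S x) \/ [/\ is_ideal S, (forall x, I x -> S x) & ~ S 1].
have [F Fgood Ftot|P [Pgood Pmax]] := @Zorn_bigcup R good.
  have [[S [FS [x Sx]]]|Fe] := pselect (exists S, F S /\ exists x, S x); last first.
    by left=> x [S FS Sx]; apply: Fe; exists S; split=> //; exists x.
  have FP T y : F T -> T y ->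
      [/\ is_ideal T, (forall x, I x -> T x) & ~ T 1].
    by move=> FT Ty; case: (Fgood T FT) => [/(_ y)|//].
  right; split.
  - split.
    + by exists S => //; have [Sid _ _] := FP _ _ FS Sx; apply: ideal0.
    + move=> y z [T FT Ty] [U FU Uz].
      have [Tid _ _] := FP _ _ FT Ty; have [Uid _ _] := FP _ _ FU Uz.
      have [TU|UT] := Ftot T U FT FU.
        by exists U => //; apply: idealD => //; apply: TU.
      by exists T => //; apply: idealD => //; apply: UT.
    + move=> a y [T FT Ty]; exists T => //.
      by have [Tid _ _] := FP _ _ FT Ty; apply: idealM.
  - by move=> y Iy; exists S => //; have [_ IS _] := FP _ _ FS Sx; apply: IS.
  - by move=> [T FT T1]; have [_ _] := FP _ _ FT T1.
have Igood : good I by right; split.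
have [Pe|[Pid IP P1]] := Pgood.
  case: (Pmax I) => //; split=> [|IP]; first by move=> x /Pe.
  exact: (Pe 0 (IP 0 (ideal0 Iid))).
exists P; split=> //; split=> // a b Pab.
apply: contrapT => /not_orP[Pa Pb]; apply: Pb.
pose J : set R := fun x => exists y r, P y /\ x = y + r * a.
have J1 : J 1.
  apply: contrapT => J1; case: (Pmax J); last first.
    right; split=> //.
    - split.
      + by exists 0, 0; split; [apply: ideal0 | rewrite mul0r addr0].
      + move=> _ _ [y [r [Py ->]]] [z [t [Pz ->]]]; exists (y + z), (r + t).
        by split; [apply: idealD | ring].
      + move=> c _ [y [r [Py ->]]]; exists (c * y), (c * r).
        by split; [apply: idealM | ring].
    - by move=> x Ix; exists x, 0; split; [apply: IP | rewrite mul0r addr0].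
  split=> [x Px|JP]; first by exists x, 0; rewrite mul0r addr0.
  apply/Pa/JP; exists 0, 1; split; first exact: ideal0.
  by rewrite mul1r add0r.
have [y [r [Py e]]] := J1.
have -> : b = b * y + r * (a * b) by rewrite -[LHS]mul1r e; ring.
by apply: idealD => //; apply: idealM.
Qed.

(* Every sequence is eventually caught by the ideal of its own initial segment:
   a form of the ascending chain condition. *)
Definition noetherian (R : comPzRingType) : Prop :=
  forall s : nat -> R, exists N (c : nat -> R), s N = \sum_(i < N) c i * s i.

Lemma field_noetherian (K : fieldType) : noetherian K.
Proof.
move=> s; have [s0|s0] := eqVneq (s 0%N) 0; first by exists 0%N, s; rewrite big_ord0.
by exists 1%N, (fun=> s 1%N / s 0%N); rewrite big_ord1 divfK.
Qed.

(** If no term of [s] is caught, elements [g n] of least size outside the span of their predecessors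
    can be chosen forever. Noetherianity of R, applied to their leading coefficients, then lets the
    leading term of some [g N] be cancelled, leaving a smaller element still outside the span. *)
Theorem hilbert_basis (R : idomainType) :
  noetherian R -> noetherian {poly R}.
Proof.
move=> Rnoeth s; apply: contrapT => /forallNP sN.
pose span (g : nat -> {poly R}) n (q : {poly R}) :=
  exists c : nat -> {poly R}, q = \sum_(i < n) c i * g i.
have span_id g n : is_ideal (span g n).
  split.
  - by exists (fun=> 0); rewrite big1 // => i _; rewrite mul0r.
  - move=> _ _ [c ->] [d ->]; exists (fun i => c i + d i).
    by rewrite -big_split /=; apply: eq_bigr => i _; rewrite mulrDl.
  - move=> a _ [c ->]; exists (fun i => a * c i); rewrite mulr_sumr.
    by apply: eq_bigr => i _; rewrite mulrA.
have span_mem g n i : (i < n)%N -> span g n (g i).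
  move=> lin; exists (fun j => (j == i)%:R).
  rewrite (bigD1 (Ordinal lin)) //= eqxx mul1r big1 ?addr0 // => j.
  by rewrite -val_eqE /= => /negbTE ->; rewrite mul0r.
have span_le g n m q : (n <= m)%N -> span g n q -> span g m q.
  move=> nm [c ->]; apply: ideal_sum => // i; apply: idealM => //.
  by apply: span_mem; apply: leq_trans nm.
pose I q := exists n, span s n q.
have fin_gen g n : (forall i, (i < n)%N -> I (g i)) ->
    exists m, forall q, span g n q -> span s m q.
  elim: n => [|n IH] gI.
    by exists 0%N => q [c ->]; rewrite big_ord0; apply: ideal0.
  have [m mP] := IH (fun i lin => gI i (ltnW lin)); have [k kP] := gI n (leqnn _).
  exists (maxn m k) => _ [c ->]; rewrite big_ord_recr /=.
  apply: idealD => //; last first.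
    by apply: idealM => //; apply: span_le kP; apply: leq_maxr.
  by apply: (span_le _ _ _ _ (leq_maxl m k)); apply: mP; exists c.
(* Stated for every list, with a dummy value when some entry is outside [I], so that [choice] yields
   a total function to recurse with. *)
have next (G : seq {poly R}) : exists q,
    (forall i, (i < size G)%N -> I G`_i) ->
    [/\ I q, ~ span (nth 0 G) (size G) q &
     forall r, I r -> ~ span (nth 0 G) (size G) r -> (size q <= size r)%N].
  have [GI|nGI] := pselect (forall i, (i < size G)%N -> I G`_i); last by exists 0.
  have [m mP] := fin_gen _ _ GI.
  have [|q [[Iq Gq] qmin]] := @exists_minimal _
    (fun q => I q /\ ~ span (nth 0 G) (size G) q) (fun q : {poly R} => size q) (s m).
    split; first by exists m.+1; apply: span_mem.
    by move=> /mP[c e]; apply: (sN m); exists c.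
  by exists q => _; split=> // r Ir Gr; apply: qmin.
have {next} [step stepP] := choice next.
pose Gs := fix Gs n := if n is n'.+1 then rcons (Gs n') (step (Gs n')) else [::].
pose g n := step (Gs n).
have sGs n : size (Gs n) = n by elim: n => //= n IH; rewrite size_rcons IH.
have nthGs n i : (i < n)%N -> (Gs n)`_i = g i.
  elim: n => // n IH; rewrite ltnS leq_eqVlt nth_rcons sGs => /orP[/eqP->|lin].
    by rewrite ltnn eqxx.
  by rewrite lin IH.
have spanGs n q : span (nth 0 (Gs n)) n q <-> span g n q.
  by split=> -[c ->]; exists c; apply: eq_bigr => i _; rewrite nthGs.
have gP n : [/\ I (g n), ~ span g n (g n) &
     forall r, I r -> ~ span g n r -> (size (g n) <= size r)%N].
  elim/ltn_ind: n => n IH.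
  have [|Ig ng gmin] := stepP (Gs n).
    by rewrite sGs => i lin; rewrite nthGs //; have [] := IH i lin.
  rewrite sGs in ng gmin; split=> // [/spanGs //|r Ir nr].
  by apply: gmin => // /spanGs.
have g_mono i n : (i <= n)%N -> (size (g i) <= size (g n))%N.
  move=> lin; have [_ _ gmin] := gP i; have [Ig ng _] := gP n.
  by apply: gmin => // /(span_le _ _ _ _ lin).
have g0 n : g n != 0.
  by apply/eqP => e; have [_ ng _] := gP n; apply: ng; rewrite e; apply: ideal0.
have [N [c cP]] := Rnoeth (fun n => lead_coef (g n)).
have [Ig ng gmin] := gP N.
pose h := \sum_(i < N) ((c i)%:P * 'X^(size (g N) - size (g i))) * g i.
have Sh : span g N h by exists (fun i => (c i)%:P * 'X^(size (g N) - size (g i))).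
have Ih : I h.
  have [|m mP] := fin_gen g N; first by move=> i _; have [] := gP i.
  by exists m; apply: mP.
have Isub x y : I x -> I y -> I (x - y).
  move=> [n nx] [m my]; exists (maxn n m); apply: idealB => //.
    exact: (span_le _ _ _ _ (leq_maxl n m)).
  exact: (span_le _ _ _ _ (leq_maxr n m)).
have := gmin (g N - h) (Isub _ _ Ig Ih).
have sz_gt0 : (0 < size (g N))%N by rewrite lt0n size_poly_eq0.
have lt_sz : (size (g N - h)%R < size (g N))%N.
  rewrite -(prednK sz_gt0) ltnS; apply/leq_sizeP => j lej.
  have szi i : (i < N)%N -> (size (g N) - size (g i) <= j)%N &&
      (j - (size (g N) - size (g i)) == j - (size (g N)).-1 + (size (g i)).-1)%N.
    move=> /ltnW/g_mono le_i; have gi0 : (0 < size (g i))%N by rewrite lt0n size_poly_eq0.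
    move: lej sz_gt0 gi0 le_i.
    move: (size (g N)) (size (g i)) => [//|a] [//|b] /= lej _ _ le_i.
    lia.
  rewrite coefB coef_sum.
  under eq_bigr => i _ do rewrite -mulrA coefCM coefXnM.
  move: lej; rewrite leq_eqVlt => /orP[/eqP ej|lt_j].
    rewrite -ej -lead_coefE cP; apply/eqP; rewrite subr_eq0; apply/eqP/eq_bigr => i _.
    have /andP[le_i /eqP e] := szi i (ltn_ord i).
    by rewrite ej ltnNge le_i /= e -ej subnn add0n.
  rewrite nth_default ?sub0r; last by rewrite -(prednK sz_gt0).
  rewrite big1 ?oppr0 // => i _; have /andP[le_i /eqP e] := szi i (ltn_ord i).
  rewrite ltnNge le_i /= e [X in _ * X]nth_default ?mulr0 //.
  apply: leq_trans (leqSpred _) _; rewrite -add1n leq_add2r.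
  by rewrite subn_gt0.
suff ngh : ~ span g N (g N - h) by move=> /(_ ngh); rewrite leqNgt lt_sz.
by move=> Sgh; apply: ng; rewrite -(subrK h (g N)); apply: idealD.
Qed.

(** A Nullstellensatz over K. Prescribing an element [c] that must not vanish is what carries the
    induction on variables: a point of the smaller ring has to keep certain leading coefficients
    nonzero. *)
Definition has_points (K R : comPzRingType) (kappa : {rmorphism K -> R}) : Prop :=
  forall (P : R -> Prop) (c : R), is_prime_ideal P -> ~ P c ->
  exists phi : {rmorphism R -> K},
    [/\ forall a, phi (kappa a) = a, forall r, P r -> phi r = 0 & phi c <> 0].

Lemma field_has_points (K : fieldType) : has_points (idfun : {rmorphism K -> K}).
Proof.
move=> P c [Pid P1 _] Pc.
have P0 r : P r -> r = 0.
  move=> Pr; apply/eqP; apply/negPn/negP => r0; apply: P1.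
  by rewrite -(mulVf r0); apply: idealM.
exists idfun; split=> // c0; apply: Pc; rewrite (_ : c = 0) //; exact: ideal0.
Qed.

Definition poly_eval (R C : comNzRingType) (phi : {rmorphism R -> C}) (y : C) :
  {rmorphism {poly R} -> C} := horner_eval y \o map_poly phi.

Lemma poly_evalE (R C : comNzRingType) (phi : {rmorphism R -> C}) y p :
  poly_eval phi y p = (map_poly phi p).[y].
Proof. by []. Qed.

Definition poly_kappa (K R : comNzRingType) (kappa : {rmorphism K -> R}) :
  {rmorphism K -> {poly R}} := polyC \o kappa.

Section PolyPoints.
Variables (K : closedFieldType) (R : idomainType) (kappa : {rmorphism K -> R}).
Hypothesis pointsR : has_points kappa.

(** Let [Q] be the contraction of [P] to R. If [P] is extended from [Q], a point of [Q] keeping a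
    coefficient of [c] is completed by any non-root of the specialized [c]. Otherwise a smallest [p]
    in [P] with a coefficient outside [Q] plays the role of a minimal polynomial, and a point of [Q]
    keeping [lead_coef p] and a resultant is completed by a root of the specialized [p]. *)
Lemma poly_has_points : has_points (poly_kappa kappa).
Proof.
move=> P c [Pid P1 PM] Pc.
pose Q b := P b%:P.
have Qprime : is_prime_ideal Q.
  rewrite /Q; split.
  - split; first by rewrite polyC0; apply: ideal0.
      by move=> x y; rewrite polyCD; apply: idealD.
    by move=> x y; rewrite polyCM; apply: idealM.
  - by rewrite polyC1.
  - by move=> a b; rewrite polyCM; apply: PM.
have [Qid _ QM] := Qprime.
have QP (q : {poly R}) : (forall i, Q q`_i) -> P q.
  move=> Qq; rewrite -[q]coefK poly_def; apply: ideal_sum => // i.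
  by rewrite -mul_polyC mulrC; apply: idealM => //; apply: Qq.
have evQ (phi : {rmorphism R -> K}) y (q : {poly R}) : (forall r, Q r -> phi r = 0) ->
    (forall i, Q q`_i) -> poly_eval phi y q = 0.
  move=> phiQ Qq; rewrite poly_evalE (_ : map_poly phi q = 0) ?horner0 //.
  by apply/polyP => i; rewrite coef_map coef0 /= phiQ.
have ev_kappa (phi : {rmorphism R -> K}) y a : (forall a, phi (kappa a) = a) ->
    poly_eval phi y (poly_kappa kappa a) = a.
  by move=> phiK; rewrite poly_evalE /= map_polyC hornerC /= phiK.
have [Pcoef|] := pselect (forall p : {poly R}, P p -> forall i, Q p`_i).
  have [i Qci] : exists i, ~ Q c`_i by apply/existsNP => Qc; apply/Pc/QP.
  have [phi [phiK phiQ phic]] := pointsR Qprime Qci.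
  have /closed_nonrootP[y /negP cy] : map_poly phi c != 0.
    by apply/eqP => /polyP/(_ i); rewrite coef_map coef0.
  exists (poly_eval phi y); split; first by move=> a; apply: ev_kappa.
    by move=> r /Pcoef Qr; apply: evQ.
  by move=> c0; apply: cy; rewrite rootE -poly_evalE c0.
move=> /existsNP[p0 /not_implyP[Pp0 /existsNP[i0 Qi0]]].
pose E (q : {poly R}) := P q /\ exists i, ~ Q q`_i.
have [p [[Pp [i Qi]] pmin]] := @exists_minimal _ E
  (fun q : {poly R} => size q) _ (conj Pp0 (ex_intro (fun i => ~ Q p0`_i) i0 Qi0)).
have small (r : {poly R}) : P r -> (size r < size p)%N -> forall i, Q r`_i.
  move=> Pr szr j; apply: contrapT => Qj.
  by have := pmin r (conj Pr (ex_intro _ j Qj)); rewrite leqNgt szr.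
have p0' : p != 0 by apply/eqP => p0'; apply: Qi; rewrite p0' coef0; apply: ideal0.
pose chop (q : {poly R}) := q - (lead_coef q)%:P * 'X^((size q).-1).
have size_chop (q : {poly R}) : q != 0 -> (size (chop q) < size q)%N.
  rewrite -size_poly_gt0 => q0; rewrite -(prednK q0) ltnS; apply/leq_sizeP => j lej.
  rewrite coefB coefCM coefXn; move: lej; rewrite leq_eqVlt => /orP[/eqP <-|ltj].
    by rewrite eqxx mulr1 lead_coefE subrr.
  rewrite gtn_eqF // mulr0 subr0 nth_default //.
  by rewrite -(prednK q0).
have P_chop (q : {poly R}) : Q (lead_coef q) -> P (q - chop q).
  by move=> Qq; rewrite opprB addrC subrK mulrC; apply: idealM.
have Qlead : ~ Q (lead_coef p).
  move=> Ql; have Qd j : Q (p - chop p)`_j.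
    rewrite opprB addrC subrK coefCM mulrC; exact: idealM.
  have Pc' : P (chop p).
    by rewrite -(subKr p (chop p)); apply: idealB => //; apply: P_chop.
  apply: Qi; have := idealD Qid (Qd i) (small _ Pc' (size_chop p p0') i).
  by rewrite coefB subrK.
(* The nonzero resultant of p and c, up to P. *)
have [b Qb [t Pt]] : exists2 b, ~ Q b & exists t, P (b%:P - t * c).
  pose D d := ~ P d /\ exists t, P (d - t * c).
  have [|d [[Pd [t Pt]] dmin]] := @exists_minimal _ D (fun q : {poly R} => size q) c.
    by split=> //; exists 1; rewrite mul1r subrr; apply: ideal0.
  have Dsmall (e : {poly R}) u : P (e - u * d) -> (size e < size d)%N -> P e.
    move=> Pe sze; apply: contrapT => nPe; have := dmin e; rewrite leqNgt sze.
    suff De : D e by move=> /(_ De).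
    split=> //; exists (u * t).
    have -> : e - u * t * c = (e - u * d) + u * (d - t * c) by ring.
    by apply: idealD => //; apply: idealM.
  have d0 : d != 0 by apply/eqP => d0; apply: Pd; rewrite d0; apply: ideal0.
  have Qd : ~ Q (lead_coef d).
    move=> Qd; apply: Pd; have Pdd := P_chop _ Qd.
    rewrite -(subrK (chop d) d); apply: idealD => //; apply: (Dsmall _ 1).
      by rewrite mul1r -opprB; apply: idealN.
    exact: size_chop.
  have szd : (size d < size p)%N.
    rewrite ltnNge; apply/negP => szpd.
    pose e := lead_coef p *: d - lead_coef d *: (p * 'X^(size d - size p)).
    have Pe : P (e - (lead_coef p)%:P * d).
      rewrite /e -!mul_polyC addrC addKr; apply: idealN => //.
      by rewrite mulrCA mulrC; do 2!apply: idealM => //; rewrite mulrC; apply: idealM.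
    have sze : (size e < size d)%N.
      have szd0 : (0 < size d)%N by rewrite size_poly_gt0.
      have szp0 : (0 < size p)%N by rewrite size_poly_gt0.
      rewrite -(prednK szd0) ltnS; apply/leq_sizeP => j lej.
      rewrite coefB !coefZ coefMXn.
      have -> : (j < size d - size p)%N = false by lia.
      move: lej; rewrite leq_eqVlt => /orP[/eqP <-|ltj].
        rewrite (_ : ((size d).-1 - (size d - size p))%N = (size p).-1); last by lia.
        by rewrite -!lead_coefE mulrC subrr.
      have ledj : (size d <= j)%N by rewrite -(prednK szd0).
      rewrite nth_default // mulr0 sub0r nth_default ?mulr0 ?oppr0 //.
      by rewrite leq_subRL ?(leq_trans (leq_subr _ _)) // subnK.
    have := Dsmall _ _ Pe sze => Pe'.
    have : P ((lead_coef p)%:P * d).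
      rewrite -(subKr e (_ * d)); apply: idealB => //.
    by case/PM.
  exists (lead_coef d); first exact: Qd.
  suff sz1 : size d = 1%N.
    have [b b0 bE] : exists2 b, b != 0 & d = b%:P by apply/size_poly1P/eqP.
    by exists t; rewrite bE lead_coefC -bE.
  (* Were [d] not constant, quotient and remainder of the pseudo-division of [p] by [d] would lie in
     [P] and be smaller than [p], so have coefficients in [Q]; then [lead_coef p] times a power of
     [lead_coef d] would be in [Q]. *)
  apply/eqP; rewrite eqn_leq size_poly_gt0 d0 andbT leqNgt; apply/negP => szd2.
  set k := scalp p d; have := Pdiv.Idomain.divp_eq p d; rewrite -/k.
  set s := p %/ d; set r := p %% d => divE.
  have szr : (size r < size d)%N by rewrite ltn_modp.
  have Pr : P r.
    apply: (Dsmall _ (- s)) => //; rewrite mulNr opprK addrC -divE -mul_polyC.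
    exact: idealM.
  have Qr := small r Pr (ltn_trans szr szd).
  have Ps : P s.
    have : P (s * d).
      rewrite -(addrK r (s * d)) -divE -mul_polyC.
      by apply: idealB => //; apply: idealM.
    by case/PM.
  have Qs : forall j, Q s`_j.
    apply: small => //; rewrite size_divp //.
    by move: szd2 szd; case: (size d) => [|[|m]] //; lia.
  have : Q (lead_coef d ^+ k * lead_coef p).
    rewrite lead_coefE -coefZ divE coefD coefM; apply: idealD => //.
    by apply: ideal_sum => // j; rewrite mulrC; apply: idealM.
  case/QM => // Qk; have {Qk} : Q (lead_coef d) \/ Q 1.
    elim: k Qk {divE} => [|k IH]; first by right.
    by rewrite exprS => /QM[]; [left | apply: IH].
  by case=> // Q1; have [] := Qprime.
have Qpb : ~ Q (lead_coef p * b) by case/QM.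
have [phi [phiK phiQ phib]] := pointsR Qprime Qpb.
have [phip phib0] : phi (lead_coef p) <> 0 /\ phi b <> 0.
  by split=> e; apply: phib; rewrite rmorphM e ?mul0r ?mulr0.
have szp1 : size (map_poly phi p) != 1%N.
  rewrite size_map_poly_id0; last exact/eqP.
  apply/eqP => sz1; have [a a0 pE] : exists2 a, a != 0 & p = a%:P by apply/size_poly1P/eqP.
  by apply: Qlead; rewrite pE lead_coefC /Q -pE.
have [y py] := closed_rootP _ szp1.
have {}py : poly_eval phi y p = 0 by apply/eqP.
have evP q : P q -> poly_eval phi y q = 0.
  move=> Pq; have := Pdiv.Idomain.divp_eq q p; set k := scalp q p => divE.
  have Pr : P (q %% p).
    have -> : q %% p = lead_coef p ^+ k *: q - q %/ p * p by rewrite divE addrC addKr.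
    by rewrite -mul_polyC; apply: idealB => //; apply: idealM.
  have Qr := small _ Pr; rewrite ltn_modp p0' in Qr.
  have := congr1 (poly_eval phi y) divE.
  rewrite rmorphD rmorphM py mulr0 add0r (evQ _ _ _ phiQ (Qr isT)) -mul_polyC rmorphM.
  rewrite [X in X * _]poly_evalE map_polyC hornerC /= rmorphXn => /eqP.
  by rewrite mulf_eq0 expf_eq0 (introF eqP phip) andbF => /eqP.
exists (poly_eval phi y); split=> // [a|c0]; first exact: ev_kappa.
have := evP _ Pt; rewrite rmorphB rmorphM c0 mulr0 subr0 poly_evalE map_polyC hornerC.
exact: phib0.
Qed.
End PolyPoints.

(** [R] is the polynomial ring in n variables, obtained by adjoining one variable at a time so that
    the two previous theorems apply by induction. The last clause says that the image of [pi] is no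
    larger than the subalgebra generated by the [c i]. *)
Lemma poly_cover (K : closedFieldType) n :
  exists (R : idomainType) (kappa : {rmorphism K -> R}),
  [/\ noetherian R, has_points kappa &
  forall (C : comNzRingType) (iota : {rmorphism K -> C}) (c : 'I_n -> C),
  exists pi : {rmorphism R -> C},
  [/\ forall a, pi (kappa a) = iota a, forall i, exists y, pi y = c i &
  forall S : C -> Prop,
    (forall x y, S x -> S y -> S (x + y)) -> (forall x y, S x -> S y -> S (x * y)) ->
    (forall a, S (iota a)) -> (forall i, S (c i)) -> forall r, S (pi r)]].
Proof.
elim: n => [|n [R [kappa [Rnoeth Rpoints Runiv]]]].
  exists K, idfun; split; [exact: field_noetherian|exact: field_has_points|].
  by move=> C iota c; exists iota; split=> // -[].
exists {poly R}, (poly_kappa kappa); split.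
- exact: hilbert_basis.
- exact: poly_has_points.
move=> C iota c; have [pi [piK pic piS]] := Runiv C iota (fun i => c (lift ord0 i)).
exists (poly_eval pi (c ord0)); split.
- by move=> a; rewrite poly_evalE /= map_polyC hornerC /= piK.
- move=> i; have [j ->|->] := unliftP ord0 i.
    by have [y <-] := pic j; exists y%:P; rewrite poly_evalE map_polyC hornerC.
  by exists 'X; rewrite poly_evalE map_polyX hornerX.
move=> S SD SM SK Sc r; rewrite poly_evalE.
have Spi := piS S SD SM SK (fun i => Sc _).
elim/poly_ind: r => [|p b IH]; first by rewrite rmorph0 horner0 -(rmorph0 iota).
rewrite rmorphD rmorphM /= map_polyX map_polyC hornerMXaddC.
apply: SD; last exact: Spi.
exact: SM.
Qed.

Lemma mpoly_ring_ind (K : nzRingType) n (S : {mpoly K[n]} -> Prop) :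
  (forall a, S a%:MP) -> (forall i, S 'X_i) ->
  (forall p q, S p -> S q -> S (p + q)) -> (forall p q, S p -> S q -> S (p * q)) ->
  forall p, S p.
Proof.
move=> SC SX SD SM; elim/mpolyind => [|c m p _ _ Sp]; first by rewrite -mpolyC0.
apply: SD => //; rewrite -mul_mpolyC; apply: (SM) => //.
rewrite mpolyXE_id; apply: (big_ind S) => [|//|i _]; first by rewrite -mpolyC1.
elim: (m i) => [|k IH]; first by rewrite expr0 -mpolyC1.
by rewrite exprS; apply: SM.
Qed.

(** * Krull intersection and coordinate rings *)

Section IdealPower.
Variables (A : comNzRingType) (n : nat) (t : 'I_n -> A).

Fixpoint ideal_pow (N : nat) (a : A) : Prop :=
  if N is N'.+1 then
    exists b : 'I_n -> A, (forall i, ideal_pow N' (b i)) /\ a = \sum_i t i * b i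
  else True.
Arguments ideal_pow : simpl never.

Lemma ideal_pow_ideal N : is_ideal (ideal_pow N).
Proof.
elim: N => [|N [I0 ID IM]]; first by split.
split=> /=.
- by exists (fun=> 0); split=> //; rewrite big1 // => i _; rewrite mulr0.
- move=> _ _ [b [bP ->]] [c [cP ->]]; exists (fun i => b i + c i).
  split=> [i|]; first by apply: ID; [apply: bP | apply: cP].
  by rewrite -big_split; apply: eq_bigr => i _; rewrite mulrDr.
- move=> a _ [b [bP ->]]; exists (fun i => a * b i).
  split=> [i|]; first by apply: IM; apply: bP.
  by rewrite mulr_sumr; apply: eq_bigr => i _; rewrite mulrCA.
Qed.

Lemma ideal_pow_gen N i a : ideal_pow N a -> ideal_pow N.+1 (t i * a).
Proof.
move=> aP; exists (fun j => if j == i then a else 0); split=> [j|].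
  by case: eqP => // _; apply: ideal0; apply: ideal_pow_ideal.
rewrite (bigD1 i) //= eqxx big1 ?addr0 // => j /negbTE ->.
by rewrite mulr0.
Qed.

Lemma ideal_powM N N' a b :
  ideal_pow N a -> ideal_pow N' b -> ideal_pow (N + N') (a * b).
Proof.
move=> aP bP; elim: N a aP => [|N IH] a.
  by move=> _; apply: idealM => //; apply: ideal_pow_ideal.
move=> [c [cP ->]]; exists (fun i => c i * b); split=> [i|]; first by apply: IH; apply: cP.
by rewrite mulr_suml; apply: eq_bigr => i _; rewrite mulrA.
Qed.

Lemma ideal_powS N a : ideal_pow N.+1 a -> ideal_pow N a.
Proof.
elim: N a => // N IH a [b [bP ->]]; exists b; split=> // i; apply: IH; apply: bP.
Qed.

End IdealPower.
Arguments ideal_pow : simpl never.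

(* The Rees ring sum_N m^N 'X^N inside A['X] is
   finitely generated, so a 'X^N is a combination of the a 'X^i with i < N; the
   coefficients of degree N of this relation give a in m a. *)
Theorem krull_intersection (K : closedFieldType) (A : comNzRingType)
    (iota : {rmorphism K -> A}) (m n : nat) (g : 'I_m -> A) (t : 'I_n -> A)
    (gen : forall S : A -> Prop,
      (forall x y, S x -> S y -> S (x + y)) -> (forall x y, S x -> S y -> S (x * y)) ->
      (forall c, S (iota c)) -> (forall i, S (g i)) -> forall a, S a) a :
  (forall N, ideal_pow t N a) -> exists y, ideal_pow t 1 y /\ a = y * a.
Proof.
move=> aP; have [R [kappa [Rnoeth _ Runiv]]] := poly_cover K (m + n).
pose c (i : 'I_(m + n)) : {poly A} :=
  match fintype.split i with inl j => (g j)%:P | inr j => t j *: 'X end.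
have [pi [piK pic piS]] := Runiv _ (poly_kappa iota) c.
pose im q := exists r, pi r = q.
have imD p q : im p -> im q -> im (p + q).
  by move=> [r <-] [s <-]; exists (r + s); rewrite rmorphD.
have imM p q : im p -> im q -> im (p * q).
  by move=> [r <-] [s <-]; exists (r * s); rewrite rmorphM.
have im0 : im 0 by exists 0; rewrite rmorph0.
have imc i : im (c i) by have [y <-] := pic i; exists y.
have imt i : im (t i *: 'X) by have := imc (rshift m i); rewrite /c -[rshift m i]/(unsplit (inr i)) unsplitK.
have imC b : im b%:P.
  apply: (gen (fun b => im b%:P)) => [x y||d|i].
  - by rewrite polyCD; apply: imD.
  - by move=> x y; rewrite polyCM; apply: imM.
  - by exists (kappa d); rewrite piK.
  - by have := imc (lshift n i); rewrite /c -[lshift n i]/(unsplit (inl i)) unsplitK.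
have im_pow N b : ideal_pow t N b -> im (b *: 'X^N).
  elim: N b => [|N IH] b; first by rewrite expr0 alg_polyC.
  move=> [d [dP ->]]; rewrite scaler_suml.
  apply: (big_ind im) => // i _.
  have -> : (t i * d i) *: 'X^(N.+1) = (t i *: 'X) * (d i *: 'X^N).
    by rewrite -scalerAl -scalerAr scalerA exprS.
  by apply: imM; [apply: imt | apply: IH; apply: dP].
(* The image of [pi] lies in the Rees ring; by the last clause of [poly_cover] this is checked on
   generators. *)
have rees r j : ideal_pow t j (pi r)`_j.
  have ip := ideal_pow_ideal t.
  move: j; apply: (piS (fun q => forall j, ideal_pow t j q`_j)).
  - by move=> p q pP qP j; rewrite coefD; apply: (idealD (ip _)).
  - move=> p q pP qP j; rewrite coefM; apply: (ideal_sum (ip _)) => // i.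
    by rewrite -[X in ideal_pow t X](subnKC (ltn_ord i : (i <= j)%N)); apply: ideal_powM.
  - by move=> d [|j]; [exact: I | rewrite coefC /=; apply: (ideal0 (ip _))].
  - move=> i j; rewrite /c; case: (fintype.split i) => k.
      by case: j => [|j]; [exact: I | rewrite coefC /=; apply: (ideal0 (ip _))].
    rewrite coefZ coefX; case: eqP => [->|_]; last by rewrite mulr0; apply: (ideal0 (ip _)).
    exact: ideal_pow_gen.
have [s sP] := choice (fun N => im_pow N a (aP N)).
have [N [d dP]] := Rnoeth s.
exists (\sum_(i < N) (pi (d i))`_(N - i)); split.
  apply: ideal_sum => [|i]; first exact: ideal_pow_ideal.
  have := rees (d i) (N - i)%N; move: _`_(N - i) => x; rewrite -(subnSK (ltn_ord i)).
  elim: (N - i.+1)%N => // k IH /ideal_powS; exact: IH.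
have := congr1 (fun r => (pi r)`_N) dP; rewrite sP coefZ coefXn eqxx mulr1 => {1}->.
rewrite rmorph_sum coef_sum mulr_suml; apply: eq_bigr => i _.
by rewrite rmorphM sP -scalerAr coefZ coefMXn ltnNge (ltnW (ltn_ord i)) /= mulrC.
Qed.

Definition der_simple (K : pzRingType) (A : comPzRingType)
    (iota : {rmorphism K -> A}) : Prop :=
  forall I : A -> Prop, is_ideal I ->
    (forall (eta : der iota) a, I a -> I (eta a)) ->
    forall a, I a -> a <> 0 -> I 1.

(** * Points, ideals and derivations of a coordinate ring *)

Section CoordinateRing.
Variables (K : closedFieldType) (n : nat) (X : set ('I_n -> K)).
Variables (A : comAlgType K) (phi : {lrmorphism {mpoly K[n]} -> A}).
Hypothesis A_coord : is_coordinate_ring X phi.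

Let lift a := projT1 (cid (A_coord.1 a)).

Let phi_lift a : phi (lift a) = a.
Proof. exact: projT2 (cid (A_coord.1 a)). Qed.

Let phi_eq p q : phi p = phi q -> vanishing_ideal X (p - q).
Proof. by move=> e; apply/A_coord.2; rewrite rmorphB /= e subrr. Qed.

Lemma coord_const c : phi c%:MP = c%:A.
Proof. by rewrite -alg_mpolyC linearZ /= rmorph1. Qed.

Lemma coord_gen (S : A -> Prop) :
  (forall x y, S x -> S y -> S (x + y)) -> (forall x y, S x -> S y -> S (x * y)) ->
  (forall c, S (GRing.in_alg A c)) -> (forall i, S (phi 'X_i)) -> forall a, S a.
Proof.
move=> SD SM SK SX a; have [p <-] := A_coord.1 a.
elim/mpoly_ring_ind: p => [c|i|p q|p q]; first by rewrite coord_const; apply: SK.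
- exact: SX.
- by rewrite rmorphD; apply: SD.
- by rewrite rmorphM; apply: SM.
Qed.

Lemma point_eval x : X x ->
  exists e : {rmorphism A -> K}, forall p, e (phi p) = p.@[x].
Proof.
move=> Xx; pose f a := (lift a).@[x].
have fE p : f (phi p) = p.@[x].
  apply/eqP; rewrite -subr_eq0 -mevalB; apply/eqP.
  by apply: phi_eq Xx; rewrite phi_lift.
have fB : zmod_morphism f.
  by move=> a b; rewrite -(phi_lift a) -(phi_lift b) -rmorphB !fE mevalB.
have fM : monoid_morphism f.
  split; first by rewrite -(rmorph1 phi) fE meval1.
  by move=> a b; rewrite -(phi_lift a) -(phi_lift b) -rmorphM !fE mevalM.
pose e : {rmorphism A -> K} := HB.pack f (GRing.isZmodMorphism.Build A K f fB)
  (GRing.isMonoidMorphism.Build A K f fM).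
by exists e.
Qed.

Lemma coord_eq0 a :
  (forall x (e : {rmorphism A -> K}), X x -> (forall p, e (phi p) = p.@[x]) -> e a = 0) ->
  a = 0.
Proof.
move=> a0; rewrite -(phi_lift a); apply/A_coord.2 => x Xx.
by have [e eP] := point_eval Xx; rewrite -eP phi_lift; apply: (a0 x).
Qed.

Lemma coord_domain (X_irr : irreducible_set X) (a b : A) : a * b = 0 -> a = 0 \/ b = 0.
Proof.
move=> ab0; have [_ irr] := X_irr.
pose Z p := [set x : 'I_n -> K | p.@[x] = 0]%classic.
have Zclosed p : zariski_closed (Z p).
  exists [set p]%classic; apply/funext => x; apply/propext; split=> /=.
    by move=> px q ->.
  by apply.
have [x Xx|Za|Zb] := irr _ _ (Zclosed (lift a)) (Zclosed (lift b)).
- have [e eP] := point_eval Xx.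
  have eE c : e c = (lift c).@[x] by rewrite -eP phi_lift.
  have /eqP : e a * e b = 0 by rewrite -rmorphM ab0 rmorph0.
  rewrite !eE mulf_eq0.
  by case/orP => /eqP ?; [left | right].
- by left; rewrite -(phi_lift a); apply/A_coord.2 => x /Za.
- by right; rewrite -(phi_lift b); apply/A_coord.2 => x /Zb.
Qed.

(** A prime containing [I] is pulled back to the cover of [poly_cover], where a K-point exists; its
    values on lifts of the coordinate functions are the coordinates of [x]. Closedness puts [x] in
    X, because the equations of X are killed by [phi]. *)
Lemma coord_nullstellensatz (X_closed : zariski_closed X) (I : A -> Prop) :
  is_ideal I -> ~ I 1 -> exists x, X x /\ forall p, I (phi p) -> p.@[x] = 0.
Proof.
move=> Iid I1; have [P [[Pid P1 PM] IP]] := prime_ideal_exists Iid I1.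
have [R [kappa [_ Rpoints Runiv]]] := poly_cover K n.
have [pi [piK pic _]] := Runiv _ (GRing.in_alg A) (fun i => phi 'X_i).
pose Q r := P (pi r).
have Qprime : is_prime_ideal Q.
  rewrite /Q; split.
  - split; first by rewrite rmorph0; apply: ideal0.
      by move=> x y; rewrite rmorphD; apply: idealD.
    by move=> x y; rewrite rmorphM; apply: idealM.
  - by rewrite rmorph1.
  - by move=> a b; rewrite rmorphM; apply: PM.
have [psi [psiK psiQ _]] := Rpoints Q 1 Qprime (@prime1 _ _ Qprime).
have [y yP] := choice pic.
pose x i := psi (y i).
have psiE p : exists r, pi r = phi p /\ psi r = p.@[x].
  elim/mpoly_ring_ind: p => [c|i|p q [r [rp rx]] [s [sq sx]]|p q [r [rp rx]] [s [sq sx]]].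
  - by exists (kappa c); rewrite piK psiK coord_const mevalC.
  - by exists (y i); rewrite yP mevalXU.
  - by exists (r + s); rewrite mevalD -rx -sx !rmorphD /= rp sq.
  - by exists (r * s); rewrite mevalM -rx -sx !rmorphM /= rp sq.
have xP p : I (phi p) -> p.@[x] = 0.
  by move=> /IP; have [r [<- <-]] := psiE p; apply: psiQ.
exists x; split=> //; have [S SE] := X_closed; rewrite SE => p Sp /=.
apply: xP; rewrite (_ : phi p = 0); first exact: ideal0.
by apply/A_coord.2; rewrite SE => z; apply.
Qed.

(** The hypothesis makes the formula independent of the polynomial lifting an element of A. *)
Lemma der_of_vector (v : 'I_n -> A) :
  (forall p, vanishing_ideal X p -> \sum_j v j * phi (mderiv j p) = 0) ->
  exists eta : der (GRing.in_alg A),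
    forall p, eta (phi p) = \sum_j v j * phi (mderiv j p).
Proof.
move=> v0; pose d (a : A) : A^o := \sum_j v j * phi (mderiv j (lift a)).
have dE p : d (phi p) = \sum_j v j * phi (mderiv j p).
  apply/eqP; rewrite -subr_eq0 -sumrB.
  rewrite (eq_bigr (fun j => v j * phi (mderiv j (lift (phi p) - p)))).
    by rewrite v0 //; apply: phi_eq; rewrite phi_lift.
  by move=> j _; rewrite mderivB rmorphB mulrBr.
have d_der : d \in derivation_pred (GRing.in_alg A).
  apply/asboolP; split.
  - move=> a b; rewrite -(phi_lift a) -(phi_lift b) -rmorphD !dE -big_split /=.
    by apply: eq_bigr => j _; rewrite mderivD rmorphD mulrDr.
  - move=> c a; rewrite -(phi_lift a) /= -scalerAl mul1r -linearZ !dE /= -scalerAl mul1r scaler_sumr.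
    by apply: eq_bigr => j _; rewrite mderivZ linearZ /= scalerAr.
  - move=> a b; rewrite -(phi_lift a) -(phi_lift b) -rmorphM !dE.
    rewrite mulr_suml mulr_sumr -big_split /=.
    by apply: eq_bigr => j _; rewrite mderivM rmorphD !rmorphM /=; ring.
by exists (Der d_der).
Qed.

End CoordinateRing.

(** * Smoothness and simplicity under derivations *)

Section Jacobian.
Variables (K : fieldType) (n : nat) (X : set ('I_n -> K)).

Definition jacobian (x : 'I_n -> K) m (p : 'I_m -> {mpoly K[n]}) : 'M[K]_(m, n) :=
  \matrix_(k, j) (mderiv j (p k)).@[x].

Definition gradient (x : 'I_n -> K) (p : {mpoly K[n]}) : 'rV[K]_n :=
  \row_j (mderiv j p).@[x].

Lemma has_dim_inj d d' : has_dim X d -> has_dim X d' -> d = d'.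
Proof.
move=> [[C Cd] dmax] [[C' Cd'] d'max]; apply/eqP; rewrite eqn_leq.
by rewrite (d'max _ _ Cd) (dmax _ _ Cd').
Qed.

Lemma conormal_basis x : exists r (p : 'I_r -> {mpoly K[n]}),
  [/\ forall k, vanishing_ideal X (p k), row_free (jacobian x p) &
   forall q, vanishing_ideal X q -> (gradient x q <= jacobian x p)%MS].
Proof.
pose Q r := exists p : 'I_r -> {mpoly K[n]},
  (forall k, vanishing_ideal X (p k)) /\ row_free (jacobian x p).
have Qn r : Q r -> (r <= n)%N.
  by move=> [p [_ /eqP <-]]; apply: rank_leq_col.
have [|r [[p [pX pfree]] rmax]] := @exists_minimal _ Q (fun r => n - r)%N 0%N.
  exists (fun=> 0); split=> [[]//|]; by rewrite /row_free -leqn0 rank_leq_row.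
exists r, p; split=> // q qX; apply/negPn/negP => nqp.
have : Q (r + 1)%N.
  exists (fun i => match fintype.split i with inl k => p k | inr _ => q end).
  split; first by move=> k; case: fintype.split.
  rewrite (_ : jacobian _ _ = col_mx (jacobian x p) (gradient x q)); last first.
    by apply/matrixP => k j; rewrite !mxE; case: fintype.split => l; rewrite mxE.
  rewrite /row_free eqn_leq rank_leq_row /= -addsmxE addn1.
  rewrite -[in X in (X < _)%N](eqP pfree).
  suff : (jacobian x p < jacobian x p + gradient x q)%MS by rewrite ltmxErank => /andP[].
  by rewrite /ltmx addsmxSl addsmx_sub submx_refl.
move=> Qr; have := Qn _ Qr; have := rmax _ Qr; lia.
Qed.

Lemma conormal_dim x r (p : 'I_r -> {mpoly K[n]}) (T : {vspace 'rV[K]_n}) :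
  (forall v, v \in T <-> tangent_vector X x v) ->
  (forall k, vanishing_ideal X (p k)) -> row_free (jacobian x p) ->
  (forall q, vanishing_ideal X q -> (gradient x q <= jacobian x p)%MS) ->
  (\dim T + r = n)%N.
Proof.
move=> TP pX pfree grad_sub; set P := jacobian x p.
pose f : 'Hom('rV[K]_n, 'rV[K]_r) := linfun (mulmxr P^T).
have -> : T = lker f.
  apply/vspaceP => v; rewrite memv_ker lfunE /=; apply/idP/eqP => [/TP vT|vP].
    apply/rowP => k; rewrite !mxE -[RHS](vT _ (pX k)).
    by apply: eq_bigr => j _; rewrite !mxE mulrC.
  apply/TP => q /grad_sub/submxP[w wP].
  have : gradient x q *m v^T = 0 by rewrite wP -mulmxA -[_ *m v^T]trmxK trmx_mul trmxK vP trmx0 mulmx0.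
  move=> /matrixP/(_ 0 0); rewrite !mxE => e; rewrite -[RHS]e.
  by apply: eq_bigr => j _; rewrite !mxE.
have := limg_ker_dim f fullv; rewrite capfv dimvf dim_matrix mul1r => e; rewrite -[RHS]e {e}.
congr (_ + _)%N; suff -> : (f @: fullv = fullv)%VS by rewrite dimvf dim_matrix mul1r.
apply/vspaceP => w; rewrite memvf; have /row_freeP[Q PQ] := pfree.
apply/memv_imgP; exists (w *m Q^T); first exact: memvf.
by rewrite lfunE /= -mulmxA -trmx_mul PQ trmx1 mulmx1.
Qed.

(** The tangent space at x is the kernel of the Jacobian of a conormal basis, so the rank is n minus
    its dimension; smoothness makes that dimension equal to the dimension of X at every point. *)
Lemma smooth_constant_rank : irreducible_set X -> smooth X ->
  exists c, forall x, X x -> exists p : 'I_c -> {mpoly K[n]},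
  [/\ forall k, vanishing_ideal X (p k), row_free (jacobian x p) &
   forall q, vanishing_ideal X q -> (gradient x q <= jacobian x p)%MS].
Proof.
move=> [[x0 Xx0] _] Xsm; have [T0 [T0P T0dim]] := Xsm _ Xx0.
exists (n - \dim T0)%N => x Xx; have [T [TP Tdim]] := Xsm _ Xx.
have [r [p [pX pfree pmax]]] := conormal_basis x.
have -> : (n - \dim T0 = r)%N.
  have := conormal_dim TP pX pfree pmax; rewrite (has_dim_inj T0dim Tdim); lia.
by exists p.
Qed.

End Jacobian.

Lemma row_free_unit_mul (K : fieldType) m n (P : 'M[K]_(m, n)) (Q : 'M[K]_(n, m)) :
  P *m Q \in unitmx -> row_free P.
Proof. by move=> u; apply/row_freeP; exists (Q *m invmx (P *m Q)); rewrite mulmxA mulmxV. Qed.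

Lemma mderivXU (R : nzRingType) n (i j : 'I_n) :
  mderiv i 'X_j = ((i == j)%:R : {mpoly R[n]}).
Proof.
rewrite mderivX mnm1E eq_sym; case: eqP => [->|_]; last by rewrite scale0r.
rewrite scale1r (_ : (_ - _)%MM = 0%MM) ?mpolyX0 //.
by apply/mnmP => k; rewrite mnmBE subnn mnm0E.
Qed.

Section LocalDerivations.
Variables (K : closedFieldType) (n : nat) (X : set ('I_n -> K)).
Variables (A : comAlgType K) (phi : {lrmorphism {mpoly K[n]} -> A}).
Hypotheses (A_coord : is_coordinate_ring X phi) (X_irr : irreducible_set X).
Hypothesis X_smooth : smooth X.
Variables (x : 'I_n -> K) (e : {rmorphism A -> K}).
Hypotheses (Xx : X x) (eP : forall p, e (phi p) = p.@[x]).

Let t i := phi 'X_i - (x i)%:A.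
Let I2id := ideal_pow_ideal t 2.
Let I1id := ideal_pow_ideal t 1.

Let pow1 i a : ideal_pow t 1 (t i * a).
Proof. exact: ideal_pow_gen. Qed.

Lemma point_const c : e c%:A = c.
Proof. by rewrite -(coord_const phi) eP mevalC. Qed.

(** First-order expansion modulo the square of the maximal ideal at [x], checked on generators, sums
    and products; in a product the only new term is the product [u * v] of the two linear parts. *)
Lemma taylor_expansion q :
  ideal_pow t 2 (phi q - (q.@[x])%:A - \sum_i t i * ((mderiv i q).@[x])%:A).
Proof.
have lin1 (c : 'I_n -> A) : ideal_pow t 1 (\sum_i t i * c i) by apply: ideal_sum.
elim/mpoly_ring_ind: q => [c|i|p q|p q].
- rewrite coord_const mevalC subrr big1 ?subrr; first exact: ideal0.
  by move=> i _; rewrite mderivC meval0 scale0r mulr0.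
- rewrite mevalXU (bigD1 i) //= big1 => [|j /negbTE ji]; last first.
    by rewrite mderivXU ji meval0 scale0r mulr0.
  rewrite mderivXU eqxx meval1 scale1r mulr1 addr0 subrr; exact: ideal0.
- move=> pP qP; have := idealD I2id pP qP; congr ideal_pow.
  under [X in _ = _ - X]eq_bigr => i _ do
    rewrite mderivD mevalD scalerDl mulrDr.
  by rewrite big_split /= rmorphD mevalD scalerDl /=; ring.
set u := \sum_i _; set v := \sum_i _ => pP qP.
have algM (c d : K) : (c * d)%:A = c%:A * d%:A :> A.
  by rewrite -scalerAl mul1r scalerA.
have -> : phi (p * q) - (p * q).@[x]%:A
      - \sum_i t i * (mderiv i (p * q)).@[x]%:A
    = (phi p - p.@[x]%:A - u) * phi q + (p.@[x]%:A + u) * (phi q - q.@[x]%:A - v)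
      + u * v.
  have -> : \sum_i t i * (mderiv i (p * q)).@[x]%:A = u * q.@[x]%:A + p.@[x]%:A * v.
    rewrite mulr_suml mulr_sumr -big_split /=; apply: eq_bigr => i _.
    by rewrite mderivM mevalD !mevalM scalerDl !algM; ring.
  by rewrite rmorphM mevalM algM /=; ring.
apply: idealD => //; last by apply: (@ideal_powM _ _ _ 1 1); apply: lin1.
apply: idealD => //; last exact: idealM.
by rewrite mulrC; apply: idealM.
Qed.

Lemma ideal_pow_sub_point a : ideal_pow t 1 (a - (e a)%:A).
Proof.
have [q <-] := A_coord.1 a; rewrite eP.
rewrite -(subrK (\sum_i t i * ((mderiv i q).@[x])%:A) (_ - _)); apply: idealD => //.
  exact/ideal_powS/taylor_expansion.
by apply: ideal_sum.
Qed.

Lemma point_ideal_pow N a : ideal_pow t N.+1 a -> e a = 0.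
Proof.
move=> [b [_ ->]]; rewrite rmorph_sum big1 // => i _.
by rewrite rmorphM /t rmorphB eP mevalXU point_const subrr mul0r.
Qed.

(* The matrix [det S - J^T adj (S^T) Q^T], with [S = J Q], annihilates the
   conormal module generically, hence everywhere, and at [x] it is a projection
   onto the tangent space. *)
Lemma euler_derivation : exists D : 'I_n -> der (GRing.in_alg A),
  forall j, ideal_pow t 2 ((\sum_i t i * D i (t j)) - t j).
Proof.
have [c rkc] := smooth_constant_rank X_irr X_smooth.
have [p [pX /row_freeP[Q PQ] _]] := rkc x Xx.
pose J : 'M[A]_(c, n) := \matrix_(k, j) phi (mderiv j (p k)).
pose QA : 'M[A]_(n, c) := map_mx (GRing.in_alg A) Q.
pose S := J *m QA; pose G : 'M[A]_n := (\det S)%:M - J^T *m \adj S^T *m QA^T.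
have evJ y (e' : {rmorphism A -> K}) : (forall q, e' (phi q) = q.@[y]) ->
    map_mx e' J = jacobian y p.
  by move=> e'P; apply/matrixP => k j; rewrite !mxE e'P.
have evQ y (e' : {rmorphism A -> K}) : (forall q, e' (phi q) = q.@[y]) ->
    map_mx e' QA = Q.
  move=> e'P; apply/matrixP => k j; rewrite !mxE /=.
  by rewrite -(coord_const phi) e'P mevalC.
have detS : e (\det S) = 1 by rewrite -det_map_mx map_mxM (evJ x) // (evQ x) // PQ det1.
(* It suffices to prove this after multiplication by [\det S], which is nonzero in a domain. Where
   [\det S] vanishes nothing is left to show; elsewhere the constant rank forces the rows of [J] to
   span all gradients of equations of X. *)
have GX q : vanishing_ideal X q -> forall i, \sum_j G i j * phi (mderiv j q) = 0.
  move=> qX i; suff /(coord_domain A_coord X_irr)[detS0|//] :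
      \det S * (\sum_j G i j * phi (mderiv j q)) = 0.
    by move: detS; rewrite detS0 rmorph0 => /eqP; rewrite eq_sym oner_eq0.
  apply: (coord_eq0 A_coord) => y e' Xy e'P; rewrite rmorphM.
  have [->|Sy] := eqVneq (e' (\det S)) 0; first by rewrite mul0r.
  pose Jy := jacobian y p; pose g := gradient y q.
  have e'S : map_mx e' S = Jy *m Q by rewrite map_mxM (evJ y) // (evQ y).
  have Su : Jy *m Q \in unitmx by rewrite unitmxE -e'S det_map_mx unitfE.
  have [p' [p'X /eqP p'free p'max]] := rkc y Xy.
  have JyJ' : (Jy <= jacobian y p')%MS.
    apply/row_subP => k; have -> : row k Jy = gradient y (p k).
      by apply/rowP => j; rewrite !mxE.
    exact: p'max.
  have /submxP[w gE] : (g <= Jy)%MS.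
    apply: submx_trans (p'max q qX) _.
    rewrite -(mxrank_leqif_sup JyJ') p'free; apply/eqP.
    exact/eqP/row_free_unit_mul/Su.
  have e'G : map_mx e' G = (\det (Jy *m Q))%:M - Jy^T *m \adj (Jy *m Q)^T *m Q^T.
    rewrite map_mxB map_scalar_mx -e'S det_map_mx !map_mxM -!map_trmx map_mx_adj.
    by rewrite -map_trmx map_mxM (evJ y) // (evQ y).
  have : map_mx e' G *m g^T = 0.
    rewrite e'G gE [(w *m _)^T]trmx_mul mulmxA mulmxBl -!mulmxA -trmx_mul mul_adj_mx det_tr.
    by rewrite mul_mx_scalar mul_scalar_mx subrr mul0mx.
  move=> /matrixP/(_ i 0) g0; apply/eqP; rewrite mulf_eq0; apply/orP; right; apply/eqP.
  have <- : (map_mx e' G *m g^T) i 0 = 0 by rewrite g0 mxE.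
  rewrite rmorph_sum mxE; apply: eq_bigr => j _.
  by rewrite rmorphM e'P [map_mx _ _ _ _]mxE [g^T _ _]mxE [g _ _]mxE.
have /choice[D DP] := fun i => der_of_vector A_coord (fun q qX => GX q qX i).
exists D => j.
have DX i : D i (t j) = G i j.
  rewrite /t -(coord_const phi) -rmorphB DP (bigD1 j) //= big1 => [|l /negbTE lj].
    by rewrite mderivB mderivXU eqxx mderivC subr0 rmorph1 mulr1 addr0.
  by rewrite mderivB mderivXU lj mderivC subr0 rmorph0 mulr0.
under eq_bigr => i _ do rewrite DX.
have eG : map_mx e G = 1%:M - (jacobian x p)^T *m Q^T.
  rewrite map_mxB map_scalar_mx detS !map_mxM -!map_trmx map_mx_adj -map_trmx map_mxM.
  by rewrite (evJ x) // (evQ x) // PQ trmx1 adj1 mulmx1.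
have eGij i : e (G i j) = (i == j)%:R - \sum_k (mderiv i (p k)).@[x] * Q j k.
  have /matrixP/(_ i j) := eG; rewrite !mxE => ->; congr (_ - _).
  by apply: eq_bigr => k _; rewrite !mxE.
(* [W] is the conormal part removed by the projection. It has order two: [p k] vanishes on X, so its
   Taylor expansion reduces to the linear part, which must then lie in the square. *)
pose W := \sum_k (Q j k)%:A * \sum_i t i * ((mderiv i (p k)).@[x])%:A.
have eGsum : \sum_i t i * (e (G i j))%:A = t j - W.
  under eq_bigr => i _ do rewrite eGij scalerBl mulrBr.
  rewrite sumrB (bigD1 j) //= eqxx scale1r mulr1 big1 => [|i /negbTE ->]; last first.
    by rewrite scale0r mulr0.
  rewrite addr0; congr (_ - _); rewrite /W.
  under eq_bigr => i _ do rewrite scaler_suml mulr_sumr.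
  rewrite exchange_big /=; apply: eq_bigr => k _; rewrite mulr_sumr.
  apply: eq_bigr => i _; rewrite mulrCA; congr (_ * _).
  by rewrite -scalerAl mul1r scalerA mulrC.
have split_G : \sum_i t i * G i j - t j =
    \sum_i t i * (G i j - (e (G i j))%:A) - W.
  under [X in _ = X - _]eq_bigr => i _ do rewrite mulrBr.
  by rewrite sumrB eGsum; ring.
rewrite split_G; apply: idealB => //; apply: ideal_sum => // i.
  apply: (@ideal_powM _ _ _ 1 1); last exact: ideal_pow_sub_point.
  by rewrite -[t i]mulr1.
apply: idealM => //; have := taylor_expansion (p i).
have -> : phi (p i) = 0 by apply/A_coord.2/pX.
by rewrite (pX i x Xx) scale0r subrr sub0r => /(idealN I2id); rewrite opprK.
Qed.

Lemma stable_ideal_pow (charK : [pchar K] =i pred0) (I : A -> Prop) :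
  is_ideal I -> (forall (eta : der (GRing.in_alg A)) a, I a -> I (eta a)) ->
  (forall a, I a -> e a = 0) -> forall N a, I a -> ideal_pow t N a.
Proof.
move=> Iid Ider Ie; have [D DP] := euler_derivation.
pose E a := \sum_i t i * D i a.
have ED a b : E (a + b) = E a + E b.
  rewrite -big_split /=; apply: eq_bigr => i _.
  by have [-> _ _] := derP (D i); rewrite mulrDr.
have EM a b : E (a * b) = E a * b + a * E b.
  rewrite mulr_suml mulr_sumr -big_split /=; apply: eq_bigr => i _.
  by have [_ _ ->] := derP (D i); ring.
have E0 : E 0 = 0 by apply: (addrI (E 0)); rewrite -ED !addr0.
have Esum (F : 'I_n -> A) : E (\sum_i F i) = \sum_i E (F i).
  by apply: (big_morph E).
(* E acts on m^N / m^(N+1) as multiplication by N. *)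
have E_pow N a : ideal_pow t N a -> ideal_pow t N.+1 (E a - a *+ N).
  elim: N a => [|N IH] a aN.
    rewrite mulr0n subr0; apply: ideal_sum => // i; exact: pow1.
  have [b [bN ->]] := aN; rewrite Esum -sumrMnl -sumrB.
  apply: ideal_sum => [|i]; first exact: ideal_pow_ideal.
  have -> : E (t i * b i) - t i * b i *+ N.+1 =
      (E (t i) - t i) * b i + t i * (E (b i) - b i *+ N).
    by rewrite EM mulrBr mulrBl mulrnAr mulrSr; ring.
  apply: idealD; first exact: ideal_pow_ideal.
    by apply: (@ideal_powM _ _ _ 2 N); [apply: DP | apply: bN].
  by apply: ideal_pow_gen; apply: IH; apply: bN.
elim=> [//|N IH] a Ia.
(* The first step cannot divide by N; it uses instead that [I] vanishes at the point. *)
have [->|N0] := eqVneq N 0%N.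
  by rewrite -(subr0 a) -(scale0r 1) -(Ie a Ia); apply: ideal_pow_sub_point.
have pid := ideal_pow_ideal t N.+1.
(* Stability enters here: each [D i a] is again in [I], hence in the N-th power, and the factor
   [t i] raises the order. *)
have EaN : ideal_pow t N.+1 (E a).
  by apply: ideal_sum => // i; apply: ideal_pow_gen; apply: IH; apply: Ider.
have := idealB pid EaN (E_pow N a (IH a Ia)); rewrite subKr => aNN.
have N0K : N%:R != 0 :> K by rewrite ((pcharf0P K).1 charK).
have -> : a = (N%:R^-1)%:A * (a *+ N).
  by rewrite -scalerAl mul1r -scaler_nat scalerA mulVf // scale1r.
exact: idealM.
Qed.
End LocalDerivations.

Theorem coord_der_simple (K : closedFieldType) (charK : [pchar K] =i pred0)
    (n : nat) (X : set ('I_n -> K))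
    (X_closed : zariski_closed X) (X_irr : irreducible_set X) (X_smooth : smooth X)
    (A : comAlgType K) (phi : {lrmorphism {mpoly K[n]} -> A})
    (A_coord : is_coordinate_ring X phi) :
  der_simple (GRing.in_alg A).
Proof.
move=> I Iid Ider a Ia a0; apply: contrapT => I1.
have [x [Xx xP]] := coord_nullstellensatz A_coord X_closed Iid I1.
have [e eP] := point_eval A_coord Xx.
have Ie b : I b -> e b = 0.
  by have [p <-] := A_coord.1 b; rewrite eP; apply: xP.
have a_pow := stable_ideal_pow A_coord X_irr X_smooth Xx eP charK Iid Ider Ie.
have [y [y1 ay]] := krull_intersection (coord_gen A_coord) (fun N => a_pow N a Ia).
have /(coord_domain A_coord X_irr)[y0|//] : (1 - y) * a = 0.
  by rewrite mulrBl mul1r -ay subrr.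
have : e (1 - y) = 1 by rewrite rmorphB rmorph1 (point_ideal_pow eP y1) subr0.
by rewrite y0 rmorph0 => /eqP; rewrite eq_sym oner_eq0.
Qed.

(** * Identities in modules *)

(* Reflection for identities in a module: both sides are reduced to linear
   combinations of the same atoms, and the coefficients are compared by [ring]. *)
Inductive mexp (A : Type) : Type :=
| MVar of nat
| MZero
| MAdd of mexp A & mexp A
| MOpp of mexp A
| MScale of A & mexp A
| MMuln of mexp A & nat.
Arguments MVar {A}.
Arguments MZero {A}.

Section ModuleReflection.
Variables (A : pzRingType) (M : lmodType A).

Fixpoint meval (env : seq M) (x : mexp A) : M :=
  match x with
  | MVar i => env`_i
  | MZero => 0
  | MAdd x y => meval env x + meval env y
  | MOpp x => - meval env x
  | MScale a x => a *: meval env x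
  | MMuln x n => meval env x *+ n
  end.

(** Indices are compared by [eqn], so that [cbn] computes the coefficients and leaves pure ring
    goals. *)
Fixpoint mcoef (x : mexp A) (i : nat) : A :=
  match x with
  | MVar j => if eqn i j then 1 else 0
  | MZero => 0
  | MAdd x y => mcoef x i + mcoef y i
  | MOpp x => - mcoef x i
  | MScale a x => a * mcoef x i
  | MMuln x n => n%:R * mcoef x i
  end.

Fixpoint mcoef_eq (n : nat) (x y : mexp A) : Prop :=
  if n is n'.+1 then mcoef x n' = mcoef y n' /\ mcoef_eq n' x y else True.

Lemma mevalE env x : meval env x = \sum_(i < size env) mcoef x i *: env`_i.
Proof.
elim: x => [j||x IHx y IHy|x IHx|a x IHx|x IHx k] /=; rewrite ?IHx ?IHy.
- have [jlt|jge] := ltnP j (size env).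
    rewrite (bigD1 (Ordinal jlt)) //= (eqxx j : eqn j j) scale1r big1 ?addr0 // => i.
    by rewrite -val_eqE /= => /negbTE ij; rewrite (ij : eqn i j = false) scale0r.
  rewrite nth_default // big1 // => i _.
  by rewrite (ltn_eqF (leq_trans (ltn_ord i) jge) : eqn i j = false) scale0r.
- by rewrite big1 // => i _; rewrite scale0r.
- by rewrite -big_split; apply: eq_bigr => i _; rewrite scalerDl.
- by rewrite -sumrN; apply: eq_bigr => i _; rewrite scaleNr.
- by rewrite scaler_sumr; apply: eq_bigr => i _; rewrite scalerA.
- by rewrite -sumrMnl; apply: eq_bigr => i _; rewrite -scalerA scaler_nat.
Qed.

Lemma meval_eq env x y : mcoef_eq (size env) x y -> meval env x = meval env y.
Proof.
move=> xy; rewrite !mevalE; apply: eq_bigr => i _; congr (_ *: _).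
elim: (size env) xy (nat_of_ord i) (ltn_ord i) => // n IH /= [e xy] j.
by rewrite ltnS leq_eqVlt => /orP[/eqP -> //|]; apply: IH.
Qed.

End ModuleReflection.

Ltac mod_index x l :=
  lazymatch l with
  | x :: _ => constr:(0%N)
  | _ :: ?l' => let i := mod_index x l' in constr:(i.+1)
  end.

Ltac mod_mem x l :=
  lazymatch l with
  | x :: _ => constr:(true)
  | _ :: ?l' => mod_mem x l'
  | _ => constr:(false)
  end.

Ltac mod_atoms x l :=
  lazymatch x with
  | (?y + ?z)%R => let l' := mod_atoms y l in mod_atoms z l'
  | (- ?y)%R => mod_atoms y l
  | (_ *: ?y)%R => mod_atoms y l
  | (?y *+ _)%R => mod_atoms y l
  | 0%R => l
  | _ => lazymatch mod_mem x l with true => l | false => constr:(x :: l) end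
  end.

Ltac mod_quote A x l :=
  lazymatch x with
  | (?y + ?z)%R => let y' := mod_quote A y l in let z' := mod_quote A z l in
      constr:(@MAdd A y' z')
  | (- ?y)%R => let y' := mod_quote A y l in constr:(@MOpp A y')
  | (?a *: ?y)%R => let y' := mod_quote A y l in constr:(@MScale A a y')
  | (?y *+ ?n)%R => let y' := mod_quote A y l in constr:(@MMuln A y' n)
  | 0%R => constr:(@MZero A)
  | _ => let i := mod_index x l in constr:(@MVar A i)
  end.

Ltac module A :=
  lazymatch goal with
  | |- @eq ?V ?x ?y =>
    let l := mod_atoms x (@nil V) in
    let l := mod_atoms y l in
    let x' := mod_quote A x l in
    let y' := mod_quote A y l in
    apply: (@meval_eq A _ l x' y'); cbn [size mcoef_eq mcoef eqn];
    repeat (split; [ring|]); exact I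
  end.

(** * The operators Omega *)

Section OmegaCalculus.
Variables (K : pzRingType) (A : comPzRingType) (iota : {rmorphism K -> A}).
Implicit Types (eta xi : der iota) (a b f : A).

Lemma der_addE eta xi a : (eta + xi) a = eta a + xi a.
Proof. by []. Qed.

Lemma der_scaleE b eta a : (b *: eta) a = b * eta a.
Proof. by []. Qed.

Lemma bracketE eta xi a : bracket eta xi a = eta (xi a) - xi (eta a).
Proof. by []. Qed.

Lemma bracketZr eta a xi :
  bracket eta (a *: xi) = eta a *: xi + a *: bracket eta xi.
Proof.
apply: der_eq => b; have [_ _ etaM] := derP eta.
by rewrite der_addE !(bracketE, der_scaleE) etaM; ring.
Qed.

Lemma bracketZl a eta xi :
  bracket (a *: eta) xi = a *: bracket eta xi - xi a *: eta.
Proof.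
apply: der_eq => b; have [_ _ xiM] := derP xi.
rewrite -scaleNr der_addE !(bracketE, der_scaleE) xiM; ring.
Qed.

Lemma bracketvv eta : bracket eta eta = 0.
Proof. by apply: der_eq => b; rewrite bracketE subrr. Qed.

Variables (M : lmodType A) (act : der iota -> M -> M).
Hypothesis actAV : AV_module act.
Implicit Types m : M.

Lemma act0r eta : act eta 0 = 0.
Proof. by apply: (addrI (act eta 0)); rewrite -(AV_Dr actAV) !addr0. Qed.

Lemma actNr eta m : act eta (- m) = - act eta m.
Proof. by apply: (addrI (act eta m)); rewrite -(AV_Dr actAV) !subrr act0r. Qed.

Lemma actBr eta m m' : act eta (m - m') = act eta m - act eta m'.
Proof. by rewrite (AV_Dr actAV) actNr. Qed.

Lemma OmegaD p f eta xi m :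
  Omega act p f (eta + xi) m = Omega act p f eta m + Omega act p f xi m.
Proof.
rewrite /Omega -big_split; apply: eq_bigr => k _.
by rewrite scalerDr (AV_Dl actAV) scalerDr.
Qed.

Lemma OmegaDr p f eta m m' :
  Omega act p f eta (m + m') = Omega act p f eta m + Omega act p f eta m'.
Proof.
rewrite /Omega -big_split; apply: eq_bigr => k _.
by rewrite (AV_Dr actAV) scalerDr.
Qed.

Lemma Omega_v0 p f m : Omega act p f 0 m = 0.
Proof. by apply: (addrI (Omega act p f 0 m)); rewrite -OmegaD !addr0. Qed.

Lemma Omega_r0 p f eta : Omega act p f eta 0 = 0.
Proof. by apply: (addrI (Omega act p f eta 0)); rewrite -OmegaDr !addr0. Qed.

Lemma OmegaNr p f eta m : Omega act p f eta (- m) = - Omega act p f eta m.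
Proof.
by apply: (addrI (Omega act p f eta m)); rewrite -OmegaDr !subrr Omega_r0.
Qed.

Lemma OmegaN p f eta m : Omega act p f (- eta) m = - Omega act p f eta m.
Proof.
by apply: (addrI (Omega act p f eta m)); rewrite -OmegaD !subrr Omega_v0.
Qed.

(** Pascal's rule, read as multiplication by X = f (x) 1 - 1 (x) f; later facts about Omega follow
    by induction from this recursion. *)
Lemma OmegaS p f eta m :
  Omega act p.+1 f eta m = f *: Omega act p f eta m - Omega act p f (f *: eta) m.
Proof.
pose F k := act (f ^+ k *: eta) m.
rewrite /Omega; under [in X in _ = _ - X]eq_bigr => k _ do
  rewrite scalerA -exprSr -/(F k.+1).
under [in X in _ = X - _]eq_bigr => k _ do rewrite -/(F k).
under [LHS]eq_bigr => k _ do rewrite -/(F k).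
rewrite big_ord_recl /= [X in _ = f *: X - _]big_ord_recl /= scalerDr -!addrA.
congr (_ + _); first by rewrite scalerA !bin0 !subn0; congr (_ *: _); rewrite exprS; ring.
rewrite scaler_sumr -sumrN.
have -> : \sum_(i < p) f *: (((-1) ^+ bump 0 i * 'C(p, bump 0 i)%:R * f ^+ (p - bump 0 i)) *: F (bump 0 i))
    = \sum_(i < p.+1) ((-1) ^+ i.+1 * 'C(p, i.+1)%:R * f ^+ (p - i)) *: F i.+1.
  rewrite big_ord_recr /= bin_small // mulr0n mulr0 mul0r scale0r addr0.
  apply: eq_bigr => i _; rewrite scalerA /bump add1n; congr (_ *: _).
  by rewrite -(subnSK (ltn_ord i)) (exprS f); ring.
rewrite -big_split; apply: eq_bigr => i _ /=; rewrite -scaleNr -scalerDl; congr (_ *: _).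
by rewrite /bump add1n binS natrD subSS exprS; ring.
Qed.

(** [eta] differentiates X into eta(f) (x) 1 - 1 (x) eta(f), whence the factor q and the order q -
    1. For q = 0 the truncated predecessor is harmless, being multiplied by zero. *)
Lemma Omega_act_comm q f eta xi m :
  act eta (Omega act q f xi m) - Omega act q f xi (act eta m) =
  (eta f *: Omega act q.-1 f xi m - Omega act q.-1 f (eta f *: xi) m) *+ q
  + Omega act q f (bracket eta xi) m.
Proof.
elim: q xi m => [|q IH] xi m; first by rewrite !Omega0 mulr0n add0r (AV_bracket actAV).
have IHa : act eta (Omega act q f xi m) = Omega act q f xi (act eta m) +
   ((eta f *: Omega act q.-1 f xi m - Omega act q.-1 f (eta f *: xi) m) *+ q
  + Omega act q f (bracket eta xi) m) by rewrite -IH addrC subrK.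
have IHb : act eta (Omega act q f (f *: xi) m) = Omega act q f (f *: xi) (act eta m) +
   ((eta f *: Omega act q.-1 f (f *: xi) m - Omega act q.-1 f (eta f *: (f *: xi)) m) *+ q
  + Omega act q f (bracket eta (f *: xi)) m) by rewrite -IH addrC subrK.
rewrite !OmegaS actBr (AV_leibniz actAV) IHa IHb bracketZr OmegaD /=.
case: q {IH IHa IHb} => [|q]; first by rewrite !mulr0n mulr1n; module A.
rewrite /= !(OmegaS q) [eta f *: (f *: xi)]scalerA [eta f * f]mulrC -scalerA.
module A.
Qed.

(** Induction on p by [OmegaS], starting from [Omega_act_comm]. The positive order of the operator
    in [xi] makes it A-linear, so that the scalar f moves across it. *)
Lemma Omega_comm p q f eta xi m :
  Omega act p.+1 f eta (Omega act q.+1 f xi m)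
    - Omega act q.+1 f xi (Omega act p.+1 f eta m) =
  Omega act (p + q).+1 f (xi f *: eta) m *+ p.+1
  - Omega act (p + q).+1 f (eta f *: xi) m *+ q.+1
  + Omega act (p + q).+2 f (bracket eta xi) m.
Proof.
elim: p eta m => [|p IH] eta m.
  rewrite OmegaS (OmegaS 0 f eta m) !Omega0.
  rewrite OmegaDr OmegaNr (Omega_linear actAV).
  have c1 := Omega_act_comm q.+1 f eta xi m.
  have c2 := Omega_act_comm q.+1 f (f *: eta) xi m.
  have -> : act eta (Omega act q.+1 f xi m) = Omega act q.+1 f xi (act eta m) +
    (act eta (Omega act q.+1 f xi m) - Omega act q.+1 f xi (act eta m)).
    by rewrite addrC subrK.
  have -> : act (f *: eta) (Omega act q.+1 f xi m) = Omega act q.+1 f xi (act (f *: eta) m) +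
    (act (f *: eta) (Omega act q.+1 f xi m) - Omega act q.+1 f xi (act (f *: eta) m)).
    by rewrite addrC subrK.
  rewrite c1 c2 bracketZl OmegaD OmegaN der_scaleE add0n (OmegaS q.+1) /=.
  rewrite (OmegaS q f (eta f *: xi)) [f *: (eta f *: xi)]scalerA.
  module A.
have -> : Omega act p.+2 f eta (Omega act q.+1 f xi m)
      - Omega act q.+1 f xi (Omega act p.+2 f eta m) =
    f *: (Omega act p.+1 f eta (Omega act q.+1 f xi m)
      - Omega act q.+1 f xi (Omega act p.+1 f eta m))
    - (Omega act p.+1 f (f *: eta) (Omega act q.+1 f xi m)
      - Omega act q.+1 f xi (Omega act p.+1 f (f *: eta) m)).
  by rewrite !(OmegaS p.+1) OmegaDr OmegaNr (Omega_linear actAV); module A.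
rewrite !IH bracketZl OmegaD OmegaN der_scaleE addSn.
rewrite (OmegaS (p + q).+2) !(OmegaS (p + q).+1).
rewrite [xi f *: (f *: eta)]scalerA [xi f * f]mulrC -!(scalerA f).
module A.
Qed.
End OmegaCalculus.

(** * Nilpotency *)

Section Nilpotency.
Variables (K : pzRingType) (A : comNzRingType) (iota : {rmorphism K -> A}).
Hypothesis A_dom : forall a b : A, a * b = 0 -> a = 0 \/ b = 0.
Hypothesis A_char : forall k, k.+1%:R <> 0 :> A.
Hypothesis A_simple : der_simple iota.
Variables (M : lmodType A) (act : der iota -> M -> M).
Hypotheses (actAV : AV_module act) (M_fin : finitely_generated M).

Let mul_neq0 (a b : A) : a <> 0 -> b <> 0 -> a * b <> 0.
Proof. by move=> a0 b0 /A_dom[]. Qed.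

Definition linearly_independent d (b : nat -> M) : Prop :=
  forall c : nat -> A, \sum_(i < d) c i *: b i = 0 -> forall i, (i < d)%N -> c i = 0.

(** A substitute for a basis over the fraction field, with one common denominator [delta]. *)
Lemma quasi_basis : exists d (b : nat -> M) (delta : A),
  [/\ linearly_independent d b, delta <> 0 &
   forall m, exists c : nat -> A, delta *: m = \sum_(i < d) c i *: b i].
Proof.
have [r [e eP]] := M_fin.
suff [d [b [delta [b_ind delta0 bP]]]] : exists d (b : nat -> M) (delta : A),
    [/\ linearly_independent d b, delta <> 0 &
     forall i : 'I_r, exists c : nat -> A, delta *: e i = \sum_(i < d) c i *: b i].
  exists d, b, delta; split=> // m; have [a ->] := eP m; have [c cP] := choice bP.
  exists (fun j => \sum_i a i * c i j).
  under [RHS]eq_bigr => j _ do rewrite scaler_suml.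
  rewrite exchange_big scaler_sumr; apply: eq_bigr => i _ /=.
  rewrite scalerA mulrC -scalerA cP scaler_sumr.
  by apply: eq_bigr => j _; rewrite scalerA.
move: e {eP}; elim: r => [|r IH] e.
  exists 0%N, (fun=> 0), 1; split=> // [|[]//]; exact/eqP/oner_neq0.
have [d [b [delta [b_ind delta0 bP]]]] := IH (fun i => e (lift ord0 i)).
have [[a [c [a0 ac]]]|no] := pselect (exists a (c : nat -> A),
    a <> 0 /\ a *: e ord0 = \sum_(i < d) c i *: b i).
  exists d, b, (delta * a); split=> // [|i]; first exact: mul_neq0.
  have [j ->|->] := unliftP ord0 i.
    have [c' c'P] := bP j; exists (fun i => a * c' i).
    rewrite mulrC -scalerA c'P scaler_sumr.
    by apply: eq_bigr => k _; rewrite scalerA.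
  exists (fun i => delta * c i); rewrite -scalerA ac scaler_sumr.
  by apply: eq_bigr => k _; rewrite scalerA.
pose b' i := if (i < d)%N then b i else e ord0.
have sum_b' (c : nat -> A) : \sum_(i < d.+1) c i *: b' i
    = \sum_(i < d) c i *: b i + c d *: e ord0.
  rewrite big_ord_recr /= /b' ltnn; congr (_ + _).
  by apply: eq_bigr => i _; rewrite ltn_ord.
exists d.+1, b', delta; split=> // [c|i].
  rewrite sum_b' => c0.
  have cd : c d = 0.
    apply: contrapT => cd; apply: no; exists (c d), (fun i => - c i); split=> //.
    under eq_bigr => i _ do rewrite scaleNr.
    by rewrite sumrN; apply/eqP; rewrite -addr_eq0 addrC c0.
  rewrite cd scale0r addr0 in c0 => i; rewrite ltnS leq_eqVlt => /orP[/eqP -> //|].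
  exact: b_ind.
have [j ->|->] := unliftP ord0 i.
  have [c cP] := bP j; pose c' i := if (i < d)%N then c i else 0.
  exists c'; rewrite sum_b' /c' ltnn scale0r addr0 cP; apply: eq_bigr => k _.
  by rewrite ltn_ord.
pose c' i := if i == d then delta else 0.
exists c'; rewrite sum_b' /c' eqxx.
by rewrite big1 ?add0r // => k _; rewrite ltn_eqF ?scale0r.
Qed.

(* The annihilator of the torsion submodule is stable under derivations, and
   nonzero because [delta M] lies in a free module. *)
Lemma torsion_free (a : A) (m : M) : a *: m = 0 -> a <> 0 -> m = 0.
Proof.
pose T (m : M) := exists a : A, a <> 0 /\ a *: m = 0.
suff T0 m' : T m' -> m' = 0 by move=> am a0; apply: T0; exists a.
pose I (c : A) := forall m, T m -> c *: m = 0.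
suff : I 1 by move=> I1 /I1; rewrite scale1r.
have Iid : is_ideal I.
  split=> [n _|b c bI cI n Tn|b c cI n Tn]; first by rewrite scale0r.
    by rewrite scalerDl bI // cI // addr0.
  by rewrite -scalerA cI // scaler0.
have [d [b [delta [b_ind delta0 bP]]]] := quasi_basis.
apply: (A_simple Iid _ _ delta0) => [eta c cI n [s [s0 sn]]|n [s [s0 sn]]].
  have /(congr1 (act eta)) := cI n (ex_intro _ s (conj s0 sn)).
  rewrite (AV_leibniz actAV) (act0r actAV) cI ?addr0 //.
  (* Multiplying 0 = eta(s n) = eta(s) n + s eta(n) by s shows that s^2 kills eta(n), which is
     therefore torsion. *)
  exists (s * s); split; first exact: mul_neq0.
  have e : eta s *: n + s *: act eta n = 0.
    by rewrite -(AV_leibniz actAV) sn (act0r actAV).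
  rewrite -scalerA -[s *: act eta n](addKr (eta s *: n)) e addr0 scalerN scalerA.
  by rewrite mulrC -scalerA sn scaler0 oppr0.
have [c cP] := bP n; rewrite cP big1 // => i _.
have : \sum_(i < d) (s * c i) *: b i = 0.
  under eq_bigr => j _ do rewrite -scalerA.
  by rewrite -scaler_sumr -cP scalerA mulrC -scalerA sn scaler0.
move=> /(b_ind (fun i => s * c i))/(_ i (ltn_ord i))/A_dom[//|->].
by rewrite scale0r.
Qed.

Lemma muln_torsion_free k (m : M) : m *+ k.+1 = 0 -> m = 0.
Proof. by rewrite -scaler_nat => /torsion_free; apply. Qed.

(** A polynomial ring has infinite rank, so D linear forms have a common zero. The free parameter k
    drives the induction: it supplies a second solution starting beyond the size of the first, so
    that the combination killing one more form is nonzero. *)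
Lemma common_kernel (L : nat -> {poly A} -> A) :
  (forall j P Q, L j (P + Q) = L j P + L j Q) ->
  (forall j a P, L j (a *: P) = a * L j P) ->
  forall D k, exists g : {poly A},
    [/\ g != 0, forall i, (i < k)%N -> g`_i = 0 & forall j, (j < D)%N -> L j g = 0].
Proof.
move=> LD LZ; elim=> [|D IH] k.
  exists 'X^k; split=> // [|i ik]; first exact/monic_neq0/monicXn.
  by rewrite coefXn ltn_eqF.
have [g1 [g1n g1k g1L]] := IH k.
have [L0|L0] := eqVneq (L D g1) 0.
  by exists g1; split=> // j; rewrite ltnS leq_eqVlt => /orP[/eqP -> //|]; apply: g1L.
have [g2 [g2n g2k g2L]] := IH (maxn k (size g1)).
exists (L D g2 *: g1 - L D g1 *: g2); split.
- apply/eqP => /polyP/(_ (size g2).-1); rewrite coefB !coefZ coef0.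
  have sz2 : (size g1 <= (size g2).-1)%N.
    rewrite leqNgt; apply/negP => lt; have /eqP := lead_coef_eq0 g2.
    rewrite (negbTE g2n) lead_coefE g2k ?eqxx //.
    by rewrite leq_max lt orbT.
  rewrite [g1`_ _]nth_default // mulr0 sub0r => /eqP; rewrite oppr_eq0 => /eqP/A_dom[].
    exact/eqP.
  by apply/eqP; rewrite -lead_coefE lead_coef_eq0.
- move=> i ik; rewrite coefB !coefZ g1k // g2k ?mulr0 ?subr0 //.
  by rewrite leq_max ik.
- move=> j; rewrite ltnS -scaleNr LD !LZ => jD.
  move: jD; rewrite leq_eqVlt => /orP[/eqP ->|jD]; first by ring.
  by rewrite (g1L j) // (g2L j) // !mulr0 addr0.
Qed.

Section Operators.
Variable f : A.
Implicit Types (P Q : {poly A}) (eta xi : der iota).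

(* The action of P(X) eta, where X = f (x) 1 - 1 (x) f in A (x) A. *)
Definition omega_poly P eta (m : M) : M :=
  \sum_(i < size P) P`_i *: Omega act i f eta m.

Lemma omega_polyE N P eta m : (size P <= N)%N ->
  omega_poly P eta m = \sum_(i < N) P`_i *: Omega act i f eta m.
Proof.
move=> PN; rewrite /omega_poly (big_ord_widen N (fun i => P`_i *: Omega act i f eta m)) //.
rewrite big_mkcond; apply: eq_bigr => i _.
by case: ltnP => // Pi; rewrite nth_default ?scale0r.
Qed.

Lemma omega_polyD P Q eta m :
  omega_poly (P + Q) eta m = omega_poly P eta m + omega_poly Q eta m.
Proof.
pose N := maxn (size (P + Q)%R) (maxn (size P) (size Q)).
rewrite !(@omega_polyE N) ?leq_max ?leqnn ?orbT // -big_split.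
by apply: eq_bigr => i _; rewrite coefD scalerDl.
Qed.

Lemma omega_polyZ a P eta m : omega_poly (a *: P) eta m = a *: omega_poly P eta m.
Proof.
rewrite (@omega_polyE (size P)) ?size_scale_leq // scaler_sumr.
by apply: eq_bigr => i _; rewrite coefZ scalerA.
Qed.

Lemma omega_poly0 eta m : omega_poly 0 eta m = 0.
Proof. by have := omega_polyZ 0 0 eta m; rewrite !scale0r. Qed.

Lemma omega_polyN P eta m : omega_poly (- P) eta m = - omega_poly P eta m.
Proof. by rewrite -(scaleN1r P) omega_polyZ scaleN1r. Qed.

Lemma omega_polyMn P k eta m : omega_poly (P *+ k) eta m = omega_poly P eta m *+ k.
Proof. by rewrite -(scaler_nat k P) omega_polyZ scaler_nat. Qed.

Lemma omega_polyXn i eta m : omega_poly 'X^i eta m = Omega act i f eta m.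
Proof.
rewrite /omega_poly size_polyXn big_ord_recr /= coefXn eqxx scale1r big1 ?add0r //.
by move=> j _; rewrite coefXn ltn_eqF // scale0r.
Qed.

Lemma omega_polyDr P eta xi m :
  omega_poly P (eta + xi) m = omega_poly P eta m + omega_poly P xi m.
Proof.
rewrite /omega_poly -big_split; apply: eq_bigr => i _.
by rewrite (OmegaD actAV) scalerDr.
Qed.

Lemma omega_poly_r0 P eta : omega_poly P eta 0 = 0.
Proof. by rewrite /omega_poly big1 // => i _; rewrite (Omega_r0 actAV) scaler0. Qed.

Lemma omega_polyDm P eta m m' :
  omega_poly P eta (m + m') = omega_poly P eta m + omega_poly P eta m'.
Proof.
rewrite /omega_poly -big_split; apply: eq_bigr => i _.
by rewrite (OmegaDr actAV) scalerDr.
Qed.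

Lemma omega_poly_linear P eta a m : P`_0 = 0 ->
  omega_poly P eta (a *: m) = a *: omega_poly P eta m.
Proof.
move=> P0; rewrite /omega_poly scaler_sumr; apply: eq_bigr => -[[|i] /= _] _.
  by rewrite P0 !scale0r scaler0.
by rewrite (Omega_linear actAV) !scalerA mulrC.
Qed.

Lemma omega_polyXM P eta m :
  omega_poly ('X * P) eta m = f *: omega_poly P eta m - omega_poly P (f *: eta) m.
Proof.
have XP : (size ('X * P)%R <= (size P).+1)%N.
  by apply: leq_trans (size_polyMleq _ _) _; rewrite size_polyX.
rewrite (omega_polyE _ _ XP) big_ord_recl coefXM eqxx scale0r add0r.
rewrite /omega_poly scaler_sumr -sumrB; apply: eq_bigr => i _.
by rewrite coefXM /= OmegaS scalerBr !scalerA mulrC.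
Qed.

Lemma polyX_ind (S : {poly A} -> Prop) :
  S 0 -> (forall i, S 'X^(i.+1)) -> (forall P Q, S P -> S Q -> S (P + Q)) ->
  (forall a P, S P -> S (a *: P)) -> forall P, P`_0 = 0 -> S P.
Proof.
move=> S0 SX SD SZ P P0; rewrite -[P]coefK poly_def.
elim/big_ind: _ => // -[[|i] /= _] _; last exact: SZ.
by rewrite P0 scale0r.
Qed.

Lemma omega_poly_comm P Q eta xi m : P`_0 = 0 -> Q`_0 = 0 ->
  omega_poly P eta (omega_poly Q xi m) - omega_poly Q xi (omega_poly P eta m) =
  omega_poly (P^`() * Q) (xi f *: eta) m - omega_poly (P * Q^`()) (eta f *: xi) m
  + omega_poly (P * Q) (bracket eta xi) m.
Proof.
move=> + Q0; move: P; apply: polyX_ind => [|p|P P' IH IH'|a P IH].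
- by rewrite deriv0 !mul0r !omega_poly0 omega_poly_r0; module A.
- move: Q Q0; apply: polyX_ind => [|q|Q Q' IH IH'|a Q IH].
  + by rewrite deriv0 !mulr0 !omega_poly0 omega_poly_r0; module A.
  + rewrite !derivXn /= mulrnAl mulrnAr -!exprD !omega_polyMn !omega_polyXn.
    by rewrite (Omega_comm actAV) addnS !addSn addnS.
  + rewrite derivD !mulrDr !omega_polyD !omega_polyDm.
    by rewrite opprD addrACA IH IH'; module A.
  + rewrite derivZ -!scalerAr !omega_polyZ (omega_poly_linear _ _ _ (_ : 'X^(p.+1)`_0 = 0)); last first.
      by rewrite coefXn.
    by rewrite -scalerBr IH scalerDr scalerBr.
- rewrite derivD !mulrDl !omega_polyD !omega_polyDm.
  by rewrite opprD addrACA IH IH'; module A.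
- rewrite derivZ -!scalerAl !omega_polyZ (omega_poly_linear _ _ _ Q0).
  by rewrite -scalerBr IH scalerDr scalerBr.
Qed.


(* Finite rank: the operators attached to g(X) mu, for g in X A[X], are A-linear,
   so they live in a torsion-free module of finite rank. *)
Lemma omega_poly_relation (mu : der iota) : exists g : {poly A},
  [/\ g != 0, g`_0 = 0 & forall m, omega_poly g mu m = 0].
Proof.
have [d [b [delta [b_ind delta0 bP]]]] := quasi_basis.
(* The values of [c0] beyond d are unconstrained; replaced by zero, they make the coordinates linear
   at every index, as [common_kernel] requires. *)
have [c0 c0P] := choice bP; pose c m l := if (l < d)%N then c0 m l else 0.
have cP m : delta *: m = \sum_(i < d) c m i *: b i.
  by rewrite c0P; apply: eq_bigr => i _; rewrite /c ltn_ord.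
have c_lin a m m' l : c (a *: m + m') l = a * c m l + c m' l.
  have [ld|] := ltnP l d; last by rewrite /c ltnNge => ->; rewrite mulr0 addr0.
  apply/eqP; rewrite -subr_eq0; apply/eqP.
  apply: (b_ind (fun l => c (a *: m + m') l - (a * c m l + c m' l))) => //.
  under eq_bigr => i _ do rewrite scalerBl scalerDl -scalerA.
  rewrite sumrB big_split /= -scaler_sumr -!cP.
  by rewrite scalerDr !scalerA mulrC subrr.
have cD m m' l : c (m + m') l = c m l + c m' l.
  by have := c_lin 1 m m' l; rewrite scale1r mul1r.
have c00 l : c 0 l = 0 by apply: (addrI (c 0 l)); rewrite -cD !addr0.
(* For j < d * d these are the matrix entries of P(X) mu in the quasi-basis, j coding a pair of
   indices. The order bound 1 then gives [g] no constant term, so its operators are A-linear. *)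
pose L j P := c (omega_poly P mu (b (j %/ d)%N)) (j %% d)%N.
have [||g [g0 g1 gL]] := @common_kernel L _ _ (d * d)%N 1%N.
- by move=> j P Q; rewrite /L omega_polyD cD.
- by move=> j a P; rewrite /L omega_polyZ -[in LHS](addr0 (a *: _)) c_lin c00 addr0.
exists g; split=> // [|m]; first exact: g1.
have gb i : (i < d)%N -> omega_poly g mu (b i) = 0.
  move=> id; apply: (torsion_free _ delta0); rewrite cP big1 // => l _.
  have := gL (i * d + l)%N; rewrite /L divnMDl ?(leq_trans _ id) //.
  rewrite divn_small // addn0 modnMDl modn_small // => ->; first by rewrite scale0r.
  by rewrite (@leq_trans (i * d + d)) ?ltn_add2l // -mulSnr leq_mul2r id orbT.
apply: (torsion_free _ delta0).
rewrite -omega_poly_linear ?g1 // cP.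
elim/big_ind: _ => [|x y x0 y0|i _]; first exact: omega_poly_r0.
  by rewrite omega_polyDm x0 y0 addr0.
by rewrite omega_poly_linear ?g1 // gb // scaler0.
Qed.

(** * Operators P(X) a mu attached to a single derivation *)

Section RankOne.
Variable mu : der iota.
Let h := mu f.
Let op P a m := omega_poly P (a *: mu) m.
Let null P a := forall m, op P a m = 0.

Let muM a b : mu (a * b) = mu a * b + a * mu b.
Proof. by have [_ _ ->] := derP mu. Qed.

Let mu1 : mu 1 = 0.
Proof. by apply: (addrI (mu 1)); have := muM 1 1; rewrite !mulr1 mul1r addr0 => <-. Qed.

Let opDl P Q a m : op (P + Q) a m = op P a m + op Q a m.
Proof. exact: omega_polyD. Qed.
Let opDr P a b m : op P (a + b) m = op P a m + op P b m.
Proof. by rewrite /op scalerDl omega_polyDr. Qed.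
Let opNl P a m : op (- P) a m = - op P a m.
Proof. exact: omega_polyN. Qed.
Let op0l a m : op 0 a m = 0.
Proof. exact: omega_poly0. Qed.
Let op0r P m : op P 0 m = 0.
Proof. by apply: (addrI (op P 0 m)); rewrite -opDr !addr0. Qed.
Let opNr P a m : op P (- a) m = - op P a m.
Proof. by apply: (addrI (op P a m)); rewrite -opDr !subrr op0r. Qed.
Let opMnr P a k m : op P (a *+ k) m = op P a m *+ k.
Proof. by elim: k => [|k IH]; rewrite ?mulr0n ?op0r // !mulrS opDr IH. Qed.
Let opMnl P a k m : op (P *+ k) a m = op P a m *+ k.
Proof. exact: omega_polyMn. Qed.

Let op_comm P Q a b m : P`_0 = 0 -> Q`_0 = 0 ->
  op P a (op Q b m) - op Q b (op P a m) =
  op (P^`() * Q - P * Q^`()) (a * b * h) m + op (P * Q) (a * mu b - b * mu a) m.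
Proof.
move=> P0 Q0; rewrite /op omega_poly_comm // omega_polyD omega_polyN.
rewrite !der_scaleE !scalerA -/h; congr (_ - _ + _).
- by congr omega_poly; congr (_ *: _); ring.
- by congr omega_poly; congr (_ *: _); ring.
congr omega_poly; rewrite bracketZr bracketZl bracketvv.
by rewrite der_scaleE; module A.
Qed.

Let null_comm P Q a b : P`_0 = 0 -> Q`_0 = 0 -> null P a -> forall m,
  op (P^`() * Q - P * Q^`()) (a * b * h) m + op (P * Q) (a * mu b - b * mu a) m = 0.
Proof.
move=> P0 Q0 Pa m; rewrite -op_comm // !Pa.
by rewrite /op omega_poly_r0 subrr.
Qed.

Let nullX P (I : A -> Prop) : (forall b a, I a -> I (b * a)) ->
  (forall a, I a -> null P a) -> forall a, I a -> null ('X * P) a.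
Proof.
move=> IM IP a Ia m; rewrite /op omega_polyXM scalerA.
by rewrite -!/(op _ _ _) !IP ?scaler0 ?subrr //; apply: IM.
Qed.

Section Relation.
Variable g : {poly A}.
Hypotheses (g0 : g`_0 = 0) (g_null : forall m, omega_poly g mu m = 0).

Let g_mul0 P : (g * P)`_0 = 0.
Proof. by rewrite coef0M g0 mul0r. Qed.

(** The bracket of the relation g mu with g k a mu: the two terms in g' cancel, leaving a kind of
    integration by parts. *)
Let rule1 k a m : op (g ^+ 2 * k) (mu a) m = op (g ^+ 2 * k^`()) (h * a) m.
Proof.
have g1 : null g 1 by move=> m'; rewrite /op scale1r.
have := null_comm a g0 (g_mul0 k) g1 m; rewrite mu1 mulr0 subr0 !mul1r.
rewrite derivM (_ : _ - _ = - (g ^+ 2 * k^`())); last by ring.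
rewrite mulrA -expr2 [a * h]mulrC /op omega_polyN => /eqP.
by rewrite addrC subr_eq0 => /eqP.
Qed.

(** By [rule1] with k = 1, g^2 mu(a) mu is null; its bracket with g^2 c mu has no term in g' and
    gives the difference of the two terms of mu(mu(a) c). Their sum is given by [rule1] with k =
    g^2; adding and dividing by 2 concludes. *)
Let rule2 a c m : op (g ^+ 4) (mu a * mu c) m = op (g ^+ 3 * g^`()) (h * mu a * c) m.
Proof.
have gg0 : (g ^+ 2)`_0 = 0 by rewrite expr2 g_mul0.
have n2 : null (g ^+ 2) (mu a).
  move=> m'; have := rule1 1 a m'; rewrite mulr1 => ->.
  by rewrite (_ : 1 = 1%:P) // derivC mulr0 op0l.
have e2 : op (g ^+ 4) (mu a * mu c) m - op (g ^+ 4) (mu (mu a) * c) m = 0.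
  have := null_comm c gg0 gg0 n2 m.
  by rewrite [_^`() * _]mulrC subrr op0l add0r -exprD opDr opNr [c * _]mulrC.
have e1 : op (g ^+ 4) (mu (mu a) * c) m + op (g ^+ 4) (mu a * mu c) m
    = op (g ^+ 3 * g^`()) (h * mu a * c) m *+ 2.
  rewrite -opDr -muM (exprD g 2 2) rule1 deriv_exp mulrA -opMnl; congr (op _ _ m).
  by rewrite mulrnAr [_ * g ^+ 1]mulrC mulrA -exprD.
apply/eqP; rewrite -subr_eq0; apply/eqP/(muln_torsion_free (k := 1)).
rewrite mulrnBl -e1 -[RHS]e2; module A.
Qed.

(** The left side of [rule2] is symmetric in a and c, the right side is not. Comparing (e, f) with
    (f, e), and using (f e, 1), where the left side is zero, isolates 2 h^2 e. *)
Lemma relation_null e : null (g ^+ 3 * g^`()) (h ^+ 2 * e).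
Proof.
move=> m; apply: (muln_torsion_free (k := 1)); rewrite -opMnr.
have e1 := rule2 (f * e) 1 m; rewrite mu1 mulr0 op0r in e1.
have e2 := rule2 e f m; have e3 := rule2 f e m.
rewrite mulrC e3 in e2.
rewrite (_ : _ *+ 2 = h * mu (f * e) * 1 + h * mu f * e - h * mu e * f).
  by rewrite opDr opNr opDr -e1 e2; module A.
by rewrite muM -/h -mulr_natr; ring.
Qed.

End Relation.

Let mu_hX q e : exists e', mu (h ^+ q.+1 * e) = h ^+ q * e'.
Proof.
elim: q e => [|q IH] e; first by exists (mu (h ^+ 1 * e)); rewrite mul1r.
have [e' e'P] := IH e; exists (mu h * e + e').
by rewrite exprS -mulrA muM e'P !exprS; ring.
Qed.

(** Bracket with X mu. Of the two extra powers of h, one is the factor mu(f) in the bracket, the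
    other makes up for the power that mu removes from h^(q+1). *)
Let euler_null q P : P`_0 = 0 -> (forall e, null P (h ^+ q * e)) ->
  forall e, null ('X * P^`()) (h ^+ q.+2 * e).
Proof.
move=> P0 Pn e m.
have Pdiv a : (exists e, a = h ^+ q * e) -> null P a by move=> [e' ->].
have Pq b : null P (h ^+ q.+1 * b) by rewrite exprSr -mulrA.
have X0 : ('X : {poly A})`_0 = 0 by rewrite coefX.
have [e' e'P] := mu_hX q e.
have nX : null ('X * P) (h ^+ q * e').
  apply: (nullX (I := fun a => exists e, a = h ^+ q * e)) => //; last by exists e'.
  by move=> b a [b' ->]; exists (b * b'); rewrite mulrCA.
have := null_comm 1 P0 X0 (Pq e) m; rewrite mu1 mulr0 sub0r mul1r derivX mulr1 mulr1.
rewrite opDl opNl e'P opNr [P * 'X]mulrC nX oppr0 addr0.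
have -> : h ^+ q.+1 * e * h = h ^+ q.+2 * e by rewrite !exprS; ring.
have -> : op P (h ^+ q.+2 * e) m = 0 by rewrite exprSr -mulrA Pq.
by rewrite [P^`() * _]mulrC subr0.
Qed.

(** With s the degree, X P' - s P is null up to more powers of h and has lost the leading term. The
    descent stops when it is zero, which in characteristic zero means that P is a monomial; P(0) = 0
    makes its degree positive. *)
Let monomial_null P q : P != 0 -> P`_0 = 0 -> (forall e, null P (h ^+ q * e)) ->
  exists s q', forall e, null 'X^(s.+1) (h ^+ q' * e).
Proof.
have [k] := ubnP (size P); elim: k P q => // k IH P q Pk Pn P0 Pnull.
pose s := (size P).-1; pose H := 'X * P^`() - P *+ s.
have H_coef i : H`_i = P`_i * i%:R - P`_i * s%:R.
  by rewrite !mulr_natr coefB coefXM coefMn; case: i => [|i] /=; rewrite ?coef_deriv.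
have sP : (0 < size P)%N by rewrite size_poly_gt0.
have Hs : (size H < size P)%N.
  rewrite -(prednK sP) ltnS; apply/leq_sizeP => i; rewrite leq_eqVlt => /orP[/eqP <-|si].
    by rewrite H_coef subrr.
  by rewrite H_coef nth_default ?mul0r ?subrr // -(prednK sP).
have [H0|H0] := eqVneq H 0; last first.
  apply: (IH H q.+2) => //; first exact: leq_trans Hs _.
    by rewrite H_coef P0 !mul0r subrr.
  move=> e m; rewrite opDl opNl euler_null // opMnl.
  by rewrite 2!exprSr -!mulrA Pnull mul0rn oppr0 addr0.
have P_lt i : (i < s)%N -> P`_i = 0.
  move=> lt; have := H_coef i; rewrite H0 coef0 -mulrBr => /esym/A_dom[//|].
  rewrite -(subnKC (ltnW lt)) natrD opprD addrA subrr sub0r => /eqP.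
  rewrite oppr_eq0 => /eqP; move: lt; rewrite -subn_gt0.
  by case: (s - i)%N => // j _ /A_char.
have PE : P = lead_coef P *: 'X^s.
  apply/polyP => i; rewrite coefZ coefXn; have [lt|gt|->] := ltngtP i s.
  - by rewrite P_lt // mulr0.
  - by rewrite nth_default ?mulr0 // -(prednK sP).
  - by rewrite mulr1 lead_coefE.
have : s != 0%N.
  by apply/eqP => s0; move: Pn; rewrite -lead_coef_eq0 lead_coefE -/s s0 P0 eqxx.
case: s PE {H H_coef Hs H0 P_lt} => // s PE _; exists s, q => e m.
have := Pnull e m; rewrite PE [op _ _ _]omega_polyZ => /torsion_free; apply.
by apply/eqP; rewrite lead_coef_eq0.
Qed.

Lemma rank_one_null : h <> 0 -> exists s q, forall e p m, (s < p)%N ->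
  Omega act p f ((h ^+ q * e) *: mu) m = 0.
Proof.
move=> h0; have [g [gn g0 g_null]] := omega_poly_relation mu.
have R0 : (g ^+ 3 * g^`())`_0 = 0 by rewrite exprS -mulrA coef0M g0 mul0r.
have Rn : g ^+ 3 * g^`() != 0.
  have mulP (P Q : {poly A}) : P != 0 -> Q != 0 -> P * Q != 0.
    move=> P0 Q0; rewrite -lead_coef_eq0 lead_coef_proper_mul.
      by apply/eqP/mul_neq0; apply/eqP; rewrite lead_coef_eq0.
    by apply/eqP/mul_neq0; apply/eqP; rewrite lead_coef_eq0.
  have g'n : g^`() != 0.
    apply/eqP => g'0; have : (size g).-1 != 0%N.
      apply/eqP => sg; move: gn; rewrite -lead_coef_eq0 lead_coefE sg g0 eqxx //.
    case sg : (size g).-1 => [//|s] _; have /polyP/(_ s) := g'0.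
    rewrite coef_deriv coef0 -sg -lead_coefE -mulr_natr => /A_dom[/eqP|].
      by rewrite lead_coef_eq0 (negbTE gn).
    by rewrite sg => /A_char.
  by rewrite !exprS expr0 mulr1; do !apply: (mulP).
have [s [q sq]] := monomial_null Rn R0 (relation_null g0 g_null).
exists s, q => e p m; elim: p e => // p IH e; rewrite ltnS leq_eqVlt => /orP[/eqP <-|sp].
  by rewrite -omega_polyXn; apply: sq.
by rewrite OmegaS IH // scalerA mulrCA IH // scaler0 subrr.
Qed.

End RankOne.

Theorem Omega_nilpotent (mu : der iota) : mu f <> 0 ->
  exists s, forall p eta m, (s < p)%N -> Omega act p f eta m = 0.
Proof.
move=> h0; have [s [q sq]] := rank_one_null h0.
pose I b := exists s, forall p eta m, (s < p)%N -> Omega act p f (b *: eta) m = 0.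
suff [s' s'P] : I 1.
  by exists s' => p eta m sp; rewrite -[eta]scale1r s'P.
have Iid : is_ideal I.
  split.
  - by exists 0%N => p eta m _; rewrite scale0r (Omega_v0 actAV).
  - move=> b c [i iP] [j jP]; exists (maxn i j) => p eta m.
    rewrite gtn_max => /andP[ip jp].
    by rewrite scalerDl (OmegaD actAV) iP // jP // addr0.
  - by move=> a b [i iP]; exists i => p eta m ip; rewrite mulrC -scalerA iP.
have Ider (xi : der iota) b : I b -> I (xi b).
  (* In the bracket of X xi with X^(p+1) b eta everything is known to vanish except X^(p+2) xi(b)
     eta; hence the bound rises by one. *)
  move=> [i iP]; exists i.+1 => -[//|[//|p]] eta m; rewrite ltnS => ip.
  have := Omega_comm actAV 0 p f xi (b *: eta) m.
  rewrite !add0n !(iP p.+1) // (Omega_r0 actAV) subrr der_scaleE -scalerA iP //.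
  rewrite scalerA [xi f * b]mulrC -scalerA iP // !mul0rn subrr add0r.
  by rewrite bracketZr (OmegaD actAV) (iP p.+2) ?(leqW ip) // addr0 => <-.
apply: (A_simple Iid Ider (a := mu f ^+ q.+1)); last first.
  by elim: q.+1 => [|k IH]; [exact/eqP/oner_neq0 | rewrite exprS; apply: mul_neq0].
exists s.+1 => -[//|p] eta m; rewrite ltnS => sp.
set b := mu f ^+ q; have nb c j x : (s < j)%N -> Omega act j f ((b * c) *: mu) x = 0.
  by move=> sj; apply: sq.
have nb1 j x : (s < j)%N -> Omega act j f (b *: mu) x = 0.
  by move=> sj; rewrite -[b]mulr1 nb.
case: p sp => // p; rewrite ltnS => sp.
(* Both brackets vanish and share the term in [b mu, eta], but contain X^(p+2) b mu(f) eta with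
   multiplicities 1 and 2; their difference isolates it. *)
have e1 := Omega_comm actAV p.+1 0 f (b *: mu) eta m.
have e2 := Omega_comm actAV p 1 f (b *: mu) eta m.
have e3 x : Omega act p.+2 f (eta f *: (b *: mu)) x = 0.
  by rewrite scalerA mulrC nb // ltnS ltnW.
rewrite addn0 !nb1 ?ltnS ?(ltnW sp) ?leqW // (Omega_r0 actAV) e3 mul0rn in e1.
rewrite addn1 !nb1 ?ltnS // (Omega_r0 actAV) e3 mul0rn in e2.
rewrite exprSr -/b -[b * mu f]/((b *: mu) f).
set u := Omega act _ f _ m in e1 e2 *; set v := Omega act _ f _ m in e1 e2.
have -> : u = (0 - u *+ 1 + v) - (0 - u *+ 2 + v) by module A.
by rewrite -e1 -e2 !subrr.
Qed.
End Operators.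
End Nilpotency.

(** * Localization *)

Local Notation frac := Defs.frac.

Section Twist.
Variables (R S : comPzRingType) (V : lmodType R) (E : lmodType S).
Implicit Types (T : V -> E) (v : V).

(** The operator s (x) 1 - 1 (x) r on maps, generalizing X. Two rings are allowed because
    derivations may be scaled in A while values are scaled in A_f. *)
Definition twist (r : R) (s : S) T : V -> E := fun v => s *: T v - T (r *: v).

(* [T] is a differential operator of order less than [n] in the direction of the
   pair [(r, s)] of corresponding scalars. *)
Definition twist_nil r s n T : Prop := forall v, iter n (twist r s) T v = 0.

Lemma twist0 r s n v : iter n (twist r s) (fun=> 0) v = 0.
Proof.
elim: n v => [//|n IH] v; rewrite iterS /twist !IH.
by rewrite scaler0 subrr.
Qed.

Lemma twist_nilS r s n T : twist_nil r s n T -> twist_nil r s n.+1 T.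
Proof. by move=> Tn v; rewrite iterS /twist !Tn scaler0 subrr. Qed.

Lemma twist_nil_le r s n n' T : (n <= n')%N -> twist_nil r s n T -> twist_nil r s n' T.
Proof.
by move=> /subnK <- Tn; elim: (n' - n)%N => //= k IH; apply: twist_nilS.
Qed.

Lemma twist_nil_twist r s n T : twist_nil r s n (twist r s T) -> twist_nil r s n.+1 T.
Proof. by move=> Tn v; rewrite iterSr Tn. Qed.

Lemma twist_nilD r s n T T' : twist_nil r s n T -> twist_nil r s n T' ->
  twist_nil r s n (fun v => T v + T' v).
Proof.
move=> Tn T'n v; suff -> : iter n (twist r s) (fun v => T v + T' v) =
    fun v => iter n (twist r s) T v + iter n (twist r s) T' v by rewrite Tn T'n addr0.
elim: n {Tn T'n} => [//|n IH]; rewrite !iterS {}IH; apply/funext => w.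
by rewrite /twist; module S.
Qed.

Lemma twist_nilZ r s n (a : S) T : twist_nil r s n T ->
  twist_nil r s n (fun v => a *: T v).
Proof.
move=> Tn v; suff -> : iter n (twist r s) (fun v => a *: T v) =
    fun v => a *: iter n (twist r s) T v by rewrite Tn scaler0.
elim: n {Tn} => [//|n IH]; rewrite !iterS {}IH; apply/funext => w.
by rewrite /twist; module S.
Qed.

Lemma twist_nilN r s n T : twist_nil r s n T -> twist_nil r s n (fun v => - T v).
Proof.
move=> Tn; have := twist_nilZ (-1) Tn; congr twist_nil.
by apply/funext => v; rewrite scaleN1r.
Qed.

Lemma twist_nilB r s n T T' : twist_nil r s n T -> twist_nil r s n T' ->
  twist_nil r s n (fun v => T v - T' v).
Proof. by move=> Tn T'n; apply: twist_nilD => //; apply: twist_nilN. Qed.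

Lemma twist_nil_comp r s n (b : R) T : twist_nil r s n T ->
  twist_nil r s n (fun v => T (b *: v)).
Proof.
move=> Tn v; suff -> : iter n (twist r s) (fun v => T (b *: v)) =
    fun v => iter n (twist r s) T (b *: v) by rewrite Tn.
elim: n {Tn} => [//|n IH]; rewrite !iterS {}IH; apply/funext => w.
by rewrite /twist !scalerA mulrC.
Qed.

Lemma twist_nil_linear r s T :
  (forall v, T (r *: v) = s *: T v) -> twist_nil r s 1 T.
Proof. by move=> TE v; rewrite /= /twist TE subrr. Qed.

(** When T kills all r v, the n-th twist is s^n T, and s is invertible. *)
Lemma twist_nil_eq0 r s t n T : t * s = 1 -> twist_nil r s n T ->
  (forall v, T (r *: v) = 0) -> forall v, T v = 0.
Proof.
move=> ts Tn T0 v.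
have twE k w : iter k (twist r s) T w = s ^+ k *: T w.
  elim: k w => [|k IH] w; first by rewrite scale1r.
  by rewrite iterS /twist !IH T0 scaler0 subr0 scalerA exprS.
have := Tn v; rewrite twE => /(congr1 (fun x => t ^+ n *: x)).
by rewrite scalerA -exprMn ts expr1n scale1r scaler0.
Qed.

End Twist.

Section LocRingTheory.
Variables (A : comPzRingType) (f : A).

Lemma loc_unit k : rfrac f 1 k * loc_inj f (f ^+ k) = 1.
Proof.
rewrite /loc_inj rfracM addn0 mul1r.
by have := rfrac_shift f k 1 0; rewrite mulr1 addn0.
Qed.

Lemma rfracE a k : rfrac f a k = rfrac f 1 k * loc_inj f a.
Proof. by rewrite /loc_inj rfracM mul1r addn0. Qed.

Lemma rfrac1D k l : rfrac f 1 (k + l) = rfrac f 1 k * rfrac f 1 l.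
Proof. by rewrite rfracM mul1r. Qed.

Lemma rfrac10 : rfrac f 1 0 = 1.
Proof. by []. Qed.

Lemma fracE (M : lmodType A) (m : M) k : frac f m k = rfrac f 1 k *: frac f m 0.
Proof. by rewrite fracZ scale1r addn0. Qed.

Lemma loc_injZ (M : lmodType A) a (m : M) k :
  loc_inj f a *: frac f m k = frac f (a *: m) k.
Proof. by rewrite fracZ. Qed.

Lemma finitely_generated_loc (M : lmodType A) :
  finitely_generated M -> finitely_generated (loc f M : lmodType (loc_ring f)).
Proof.
move=> [r [e eP]]; exists r, (fun i => frac f (e i) 0).
elim/fracW=> m k; have [c ->] := eP m; exists (fun i => rfrac f (c i) k).
under [RHS]eq_bigr => i _ do rewrite fracZ addn0.
elim/big_ind2: _ => [|x x' y y' <- <-|//]; [exact: frac0 | exact: fracDs].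
Qed.

End LocRingTheory.

Section LocDerivation.
Variables (K : pzRingType) (A : comPzRingType) (iota : {rmorphism K -> A}) (f : A).
Implicit Types (eta xi : der iota) (D : der (loc_iota iota f)).

Lemma der1 (B : comPzRingType) (kappa : {rmorphism K -> B}) (d : der kappa) : d 1 = 0.
Proof.
have [_ _ dM] := derP d; apply: (addrI (d 1)).
by have := dM 1 1; rewrite !mulr1 mul1r addr0 => <-.
Qed.

Lemma der_const (B : comPzRingType) (kappa : {rmorphism K -> B}) (d : der kappa) c :
  d (kappa c) = 0.
Proof. by have [_ dZ _] := derP d; rewrite -[kappa c]mulr1 dZ der1 mulr0. Qed.

Lemma loc_der_ext D D' :
  (forall a, D (loc_inj f a) = D' (loc_inj f a)) -> D = D'.
Proof.
move=> DD'; apply: der_eq => s; elim/rfracW: s => a k.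
have unit_eq (x y : loc_ring f) : x * loc_inj f (f ^+ k) = y * loc_inj f (f ^+ k) -> x = y.
  move=> /(congr1 (fun z => z * rfrac f 1 k)).
  by rewrite -!mulrA [loc_inj _ _ * _]mulrC loc_unit !mulr1.
have [_ _ DM] := derP D; have [_ _ D'M] := derP D'.
apply: unit_eq; apply: (addIr (rfrac f a k * D (loc_inj f (f ^+ k)))).
rewrite -DM DD' -D'M rfracE -mulrA [loc_inj _ _ * loc_inj _ _]mulrC mulrA loc_unit mul1r.
exact: DD'.
Qed.

Lemma loc_derD eta xi : loc_der f (eta + xi) = loc_der f eta + loc_der f xi.
Proof.
apply: loc_der_ext => a; rewrite der_addE !loc_derE.
by rewrite der_addE rmorphD.
Qed.

Lemma loc_derZ a eta : loc_der f (a *: eta) = loc_inj f a *: loc_der f eta.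
Proof. by apply: loc_der_ext => b; rewrite der_scaleE !loc_derE -rmorphM. Qed.

Lemma loc_der_bracket eta xi :
  loc_der f (bracket eta xi) = bracket (loc_der f eta) (loc_der f xi).
Proof. by apply: loc_der_ext => b; rewrite !(bracketE, loc_derE) rmorphB. Qed.

Lemma frac_der0 eta : frac_der f eta 0 = loc_der f eta.
Proof. by rewrite /frac_der rfrac10 scale1r. Qed.

Lemma frac_derD eta xi k : frac_der f (eta + xi) k = frac_der f eta k + frac_der f xi k.
Proof. by rewrite /frac_der loc_derD scalerDr. Qed.

Lemma frac_derZ a eta k : frac_der f (a *: eta) k = loc_inj f a *: frac_der f eta k.
Proof. by rewrite /frac_der loc_derZ !scalerA mulrC. Qed.

Lemma frac_der_shift eta k l : frac_der f (f ^+ l *: eta) (k + l) = frac_der f eta k.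
Proof. by rewrite /frac_der loc_derZ rfrac1D scalerA -mulrA loc_unit mulr1. Qed.

End LocDerivation.

(** * The action of Der(A_f) on M_f *)

Section LocAction.
Variables (K : pzRingType) (A : comPzRingType) (iota : {rmorphism K -> A}) (f : A).
Variables (M : lmodType A) (act : der iota -> M -> M).
Hypothesis actAV : AV_module act.
Implicit Types (eta xi : der iota) (g a : A) (x y : loc f M) (s : loc_ring f).

Let act0 eta x : loc f M := quot_rule eta (act eta) x.

Lemma quot_actE eta m j :
  act0 eta (frac f m j) = frac f (f *: act eta m - (eta f *+ j) *: m) j.+1.
Proof.
have [etaD etaZ etaM] := derP eta.
rewrite /act0 quot_ruleE //; last by move=> a n; apply: (AV_leibniz actAV).
by rewrite -(frac_shift f 1 (act eta m)) expr1 add1n fracN -fracDs addrC.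
Qed.

Lemma quot_act_frac0 eta m : act0 eta (frac f m 0) = frac f (act eta m) 0.
Proof.
rewrite quot_actE mulr0n scale0r subr0.
by have := frac_shift f 1 (act eta m) 0; rewrite expr1.
Qed.

Lemma frac_eq (m m' : M) i j : f ^+ j *: m = f ^+ i *: m' -> frac f m i = frac f m' j.
Proof. by move=> e; apply/fracP; exists 0%N. Qed.

Let leibX eta k m : f *: act eta (f ^+ k *: m)
  = ((eta f *+ k) * f ^+ k) *: m + f ^+ k.+1 *: act eta m.
Proof.
have [etaD etaZ etaM] := derP eta.
by rewrite (AV_leibniz actAV) scalerDr !scalerA (leibnizX _ _ etaM) exprS.
Qed.

Lemma quot_actD eta x y : act0 eta (x + y) = act0 eta x + act0 eta y.
Proof.
elim/fracW: x => m i; elim/fracW: y => n j.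
rewrite fracD !quot_actE fracD; apply: frac_eq.
rewrite (AV_Dr actAV) [f *: (_ + _)]scalerDr !leibX mulrnDr !(exprD, exprS).
module A.
Qed.

Lemma quot_act_leibniz eta s x :
  act0 eta (s *: x) = loc_der f eta s *: x + s *: act0 eta x.
Proof.
have [etaD etaZ etaM] := derP eta.
elim/rfracW: s => a i; elim/fracW: x => m j.
have -> : loc_der f eta (rfrac f a i) = rfrac f (f * eta a - (eta f *+ i) * a) i.+1.
  rewrite /= quot_ruleE // -/(rfrac f (eta a) i) -(rfrac_shift f 1) expr1 add1n addrC.
  by rewrite rfracDs /rfrac fracN.
rewrite fracZ !quot_actE !fracZ fracD; apply: frac_eq.
rewrite (AV_leibniz actAV) mulrnDr !(exprD, exprS).
module A.
Qed.

(** For p = 0 this reconciles the two clauses of [Omega_loc]: the correction term of the quotient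
    rule is A-linear in eta and cancels. *)
Lemma Omega_locS p g eta x :
  Omega_loc act p.+1 g eta x =
  loc_inj f g *: Omega_loc act p g eta x - Omega_loc act p g (g *: eta) x.
Proof.
elim/fracW: x => m j; rewrite (Omega_locE f actAV) OmegaS.
case: p => [|p]; last by rewrite !(Omega_locE f actAV) loc_injZ fracN -fracDs.
rewrite !Omega0 /Omega_loc -!/(act0 _ _) !quot_actE loc_injZ fracN -fracDs.
apply: frac_eq; rewrite der_scaleE exprS.
module A.
Qed.

Lemma Omega_loc_iter p g eta x :
  iter p (twist g (loc_inj f g)) (fun eta => act0 eta x) eta = Omega_loc act p g eta x.
Proof. by elim: p eta => [//|p IH] eta; rewrite Omega_locS iterS /twist !IH. Qed.

Lemma Omega_locD p g eta xi x :
  Omega_loc act p g (eta + xi) x = Omega_loc act p g eta x + Omega_loc act p g xi x.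
Proof.
elim: p eta xi => [|p IH] eta xi; last by rewrite !Omega_locS scalerDr !IH; module (loc_ring f).
elim/fracW: x => m j; rewrite /Omega_loc -!/(act0 _ _) !quot_actE -fracDs.
congr (frac f _ _); rewrite (AV_Dl actAV) der_addE mulrnDl.
module A.
Qed.

Lemma Omega_locDr p g eta x y :
  Omega_loc act p g eta (x + y) = Omega_loc act p g eta x + Omega_loc act p g eta y.
Proof.
elim: p eta => [|p IH] eta; first exact: quot_actD.
by rewrite !Omega_locS !IH; module (loc_ring f).
Qed.

Variable N : nat -> nat.
Hypothesis Omega_nil : forall k p eta m,
  (N k < p)%N -> Omega act p (f ^+ k) eta m = 0.

Lemma Omega_loc_nil k p eta x : (N k < p)%N -> Omega_loc act p (f ^+ k) eta x = 0.
Proof.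
case: p => // p Np; elim/fracW: x => m j.
by rewrite (Omega_locE f actAV) Omega_nil // frac0.
Qed.

Definition frac_act k eta x : loc f M :=
  \sum_(p < (N k).+1) rfrac f 1 (k * p.+1) *: Omega_loc act p (f ^+ k) eta x.

Lemma frac_act_finite k eta x : is_finite_sum
  (fun p => rfrac f 1 (k * p.+1) *: Omega_loc act p (f ^+ k) eta x) (frac_act k eta x).
Proof.
by exists (N k).+1; split=> // p Np; rewrite Omega_loc_nil // scaler0.
Qed.

Lemma frac_actD k eta xi x : frac_act k (eta + xi) x = frac_act k eta x + frac_act k xi x.
Proof.
by rewrite -big_split; apply: eq_bigr => p _; rewrite Omega_locD scalerDr.
Qed.

Lemma frac_actDr k eta x y : frac_act k eta (x + y) = frac_act k eta x + frac_act k eta y.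
Proof.
by rewrite -big_split; apply: eq_bigr => p _; rewrite Omega_locDr scalerDr.
Qed.

(** Since 1 (x) f^k is f^k (x) 1 - X, the geometric series telescopes; its last term is beyond the
    bound [N k]. *)
Lemma frac_act_expZ k eta x : frac_act k (f ^+ k *: eta) x = act0 eta x.
Proof.
pose F p := - (rfrac f 1 (k * p) *: Omega_loc act p (f ^+ k) eta x).
rewrite /frac_act (eq_bigr (fun p : 'I_(N k).+1 => F p.+1 - F p)) => [|p _].
  rewrite -(big_mkord xpredT (fun p => F p.+1 - F p)) telescope_sumr //.
  by rewrite /F Omega_loc_nil // scaler0 oppr0 sub0r opprK muln0 rfrac10 scale1r.
rewrite /F; have -> : rfrac f 1 (k * p) = rfrac f 1 (k * p.+1) * loc_inj f (f ^+ k).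
  by rewrite mulnS addnC rfrac1D -mulrA loc_unit mulr1.
by rewrite Omega_locS; module (loc_ring f).
Qed.

Lemma act_twist_nil k x :
  twist_nil (f ^+ k) (loc_inj f (f ^+ k)) (N k).+1 (fun eta => act0 eta x).
Proof. by move=> eta; rewrite Omega_loc_iter Omega_loc_nil. Qed.

(** The series is built with f^l, the twist with f^k. Each term is a combination of maps eta |->
    act0 (a eta) x, and twists commute with scaling and precomposition, so the bound for f^k is
    inherited. *)
Lemma frac_act_twist_nil k l x :
  twist_nil (f ^+ k) (loc_inj f (f ^+ k)) (N k).+1 (fun eta => frac_act l eta x).
Proof.
rewrite /frac_act; elim: (N l).+1 => [|n IH].
  by move=> eta; under eq_fun do rewrite big_ord0; apply: twist0.
under eq_fun do rewrite big_ord_recr /=.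
apply: twist_nilD => //; apply: twist_nilZ.
elim: (n) => [|p IHp]; first exact: act_twist_nil.
under eq_fun do rewrite Omega_locS.
by apply: twist_nilB; [apply: twist_nilZ | apply: (twist_nil_comp _ IHp)].
Qed.

(** Independence of the fraction representing a derivation: both sides agree on multiples f^k eta by
    [frac_act_expZ], and nilpotency extends this to all eta. *)
Lemma frac_act_shift k l eta x : frac_act (k + l) (f ^+ l *: eta) x = frac_act k eta x.
Proof.
apply/eqP; rewrite -subr_eq0; apply/eqP; move: eta.
apply: (@twist_nil_eq0 _ _ _ _ _ _ _ (N k).+1 _ (loc_unit f k)).
  apply: twist_nilB; last exact: frac_act_twist_nil.
  apply: (@twist_nil_comp _ _ _ _ _ _ _ _ (fun eta => frac_act (k + l) eta x)).
  exact: frac_act_twist_nil.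
by move=> eta; rewrite scalerA -exprD addnC !frac_act_expZ subrr.
Qed.


Hypothesis loc_inj_inj : injective (loc_inj f).
Hypothesis frac_der_surj : forall D : der (loc_iota iota f),
  exists p : der iota * nat, D = frac_der f p.1 p.2.
Implicit Type D : der (loc_iota iota f).

Definition loc_act D x : loc f M :=
  let p := projT1 (cid (frac_der_surj D)) in frac_act p.2 p.1 x.

Lemma loc_actE eta k x : loc_act (frac_der f eta k) x = frac_act k eta x.
Proof.
rewrite /loc_act; case: cid => -[xi l] /= e.
have {}e : f ^+ l *: eta = f ^+ k *: xi.
  apply: der_eq => a; apply: loc_inj_inj; rewrite -!loc_derE; congr (der_app _ _).
  have: frac_der f (f ^+ l *: eta) (k + l) = frac_der f (f ^+ k *: xi) (l + k).
    by rewrite !frac_der_shift.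
  rewrite addnC => /(congr1 (fun D => loc_inj f (f ^+ (l + k)) *: D)).
  by rewrite /frac_der !scalerA mulrC loc_unit !scale1r.
by rewrite -(frac_act_shift k l) e addnC frac_act_shift.
Qed.

Lemma loc_act_loc_der eta x : loc_act (loc_der f eta) x = act0 eta x.
Proof. by rewrite -frac_der0 loc_actE -[eta]scale1r frac_act_expZ scale1r. Qed.

Lemma loc_act_twist_nil x :
  twist_nil (loc_inj f f) (loc_inj f f) (N 1).+1 (fun D => loc_act D x).
Proof.
move=> D; have [[eta k] ->] := frac_der_surj D.
have it n xi : iter n (twist (loc_inj f f) (loc_inj f f)) (fun D => loc_act D x)
    (frac_der f xi k) = iter n (twist f (loc_inj f f)) (fun xi => frac_act k xi x) xi.
  elim: n xi => [|n IH] xi /=; first exact: loc_actE.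
  by rewrite /twist -frac_derZ !IH.
by rewrite it; have := @frac_act_twist_nil 1 k x eta; rewrite expr1.
Qed.

(** Induction on the denominator: the map eta |-> T(eta / f^(k+1)) vanishes on f eta by the previous
    case, so [twist_nil_eq0] applies. *)
Lemma loc_der_eq0 n (T : der (loc_iota iota f) -> loc f M) :
  twist_nil (loc_inj f f) (loc_inj f f) n T ->
  (forall eta, T (loc_der f eta) = 0) -> forall D, T D = 0.
Proof.
move=> Tn T0 D; have [[eta k] ->] := frac_der_surj D; move=> /=.
elim: k eta {D} => [|k IH] eta; first by rewrite frac_der0.
move: eta; apply: (@twist_nil_eq0 _ _ _ _ f (loc_inj f f) (rfrac f 1 1) n
    (fun eta => T (frac_der f eta k.+1))).
- by have := loc_unit f 1; rewrite expr1.
- move=> eta.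
  have it i xi : iter i (twist f (loc_inj f f)) (fun xi => T (frac_der f xi k.+1)) xi =
      iter i (twist (loc_inj f f) (loc_inj f f)) T (frac_der f xi k.+1).
    by elim: i xi => [//|i IHi] xi; rewrite !iterS /twist !IHi frac_derZ.
  by rewrite it Tn.
- by move=> eta; have := frac_der_shift f eta k 1; rewrite expr1 addn1 => ->.
Qed.

Lemma loc_actDr D x y : loc_act D (x + y) = loc_act D x + loc_act D y.
Proof. exact: frac_actDr. Qed.

Lemma loc_act_r0 D : loc_act D 0 = 0.
Proof. by apply: (addrI (loc_act D 0)); rewrite -loc_actDr !addr0. Qed.

Lemma loc_actNr D x : loc_act D (- x) = - loc_act D x.
Proof. by apply: (addrI (loc_act D x)); rewrite -loc_actDr !subrr loc_act_r0. Qed.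

Lemma loc_actDl D D' x : loc_act (D + D') x = loc_act D x + loc_act D' x.
Proof.
have [[eta k] ->] := frac_der_surj D; have [[xi l] ->] := frac_der_surj D'; move=> /=.
rewrite -(frac_der_shift f eta k l) -(frac_der_shift f xi l k) addnC -frac_derD.
by rewrite !loc_actE frac_actD.
Qed.

Lemma loc_act_leibniz D s x : loc_act D (s *: x) = D s *: x + s *: loc_act D x.
Proof.
apply/eqP; rewrite -subr_eq0; apply/eqP; move: D.
apply: (@loc_der_eq0 (N 1).+1) => [|eta]; last first.
  by rewrite !loc_act_loc_der quot_act_leibniz subrr.
apply: twist_nilB; first exact: loc_act_twist_nil.
apply: twist_nilD; last by apply: twist_nilZ; apply: loc_act_twist_nil.
apply: (@twist_nil_le _ _ _ _ _ _ 1) => //; apply: twist_nil_linear => D.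
by rewrite der_scaleE scalerA.
Qed.

Lemma loc_actZl (c : K) D x :
  loc_act (loc_iota iota f c *: D) x = loc_iota iota f c *: loc_act D x.
Proof.
apply/eqP; rewrite -subr_eq0; apply/eqP; move: D.
apply: (@loc_der_eq0 (N 1).+1) => [|eta].
  apply: twist_nilB; last by apply: twist_nilZ; apply: loc_act_twist_nil.
  by apply: (@twist_nil_comp _ _ _ _ _ _ _ _ (fun D => loc_act D x)); apply: loc_act_twist_nil.
rewrite -loc_derZ !loc_act_loc_der; elim/fracW: x => m j.
rewrite !quot_actE loc_injZ (AV_Zl actAV) der_scaleE.
by apply/eqP; rewrite subr_eq0; apply/eqP; congr (frac f _ _); module A.
Qed.

(** By the Leibniz rule, twisting the composite gives the composite with the twist of T, minus D(f)
    T; composing with D thus costs one order. *)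
Lemma twist_nil_act D n (T : der (loc_iota iota f) -> loc f M) :
  twist_nil (loc_inj f f) (loc_inj f f) n T ->
  twist_nil (loc_inj f f) (loc_inj f f) n.+1 (fun D' => loc_act D (T D')).
Proof.
elim: n T => [|n IH] T Tn.
  apply: (@twist_nil_le _ _ _ _ _ _ 0) => // D' /=.
  by rewrite [T D'](Tn D') loc_act_r0.
have Tn' : twist_nil (loc_inj f f) (loc_inj f f) n (twist (loc_inj f f) (loc_inj f f) T).
  by move=> D'; rewrite -iterSr.
apply: twist_nil_twist.
rewrite (_ : twist _ _ _ = fun D' => loc_act D (twist (loc_inj f f) (loc_inj f f) T D')
    - D (loc_inj f f) *: T D'); last first.
  apply/funext => D'; rewrite /twist loc_actDr loc_actNr loc_act_leibniz.
  by module (loc_ring f).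
by apply: twist_nilB; [apply: IH | apply: twist_nilZ].
Qed.

(** The same count, from [f D', D] = f [D', D] - D(f) D'. *)
Lemma twist_nil_bracket D n (T : der (loc_iota iota f) -> loc f M) :
  (forall D1 D2, T (D1 + D2) = T D1 + T D2) ->
  twist_nil (loc_inj f f) (loc_inj f f) n T ->
  twist_nil (loc_inj f f) (loc_inj f f) n.+1 (fun D' => T (bracket D' D)).
Proof.
elim: n T => [|n IH] T TD Tn.
  apply: (@twist_nil_le _ _ _ _ _ _ 0) => // D' /=.
  exact: (Tn (bracket D' D)).
have Tn' : twist_nil (loc_inj f f) (loc_inj f f) n (twist (loc_inj f f) (loc_inj f f) T).
  by move=> D'; rewrite -iterSr.
apply: twist_nil_twist.
rewrite (_ : twist _ _ _ = fun D' => twist (loc_inj f f) (loc_inj f f) T (bracket D' D)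
    + T (D (loc_inj f f) *: D')); last first.
  apply/funext => D'; rewrite /twist bracketZl.
  have TB u v : T (u - v) = T u - T v by apply: (addIr (T v)); rewrite -TD !subrK.
  by rewrite TB opprD opprK addrA.
apply: twist_nilD; last exact: (twist_nil_comp _ Tn).
apply: IH => // D1 D2; rewrite /twist [_ *: (D1 + D2)]scalerDr !TD scalerDr.
by rewrite opprD addrACA.
Qed.

Let bracket_formula D D' := forall x,
  loc_act (bracket D D') x = loc_act D (loc_act D' x) - loc_act D' (loc_act D x).

Lemma bracketC (B : comPzRingType) (kappa : {rmorphism K -> B}) (d e : der kappa) :
  bracket d e = - bracket e d.
Proof. by apply: der_eq => a; rewrite [RHS](_ : _ = - bracket e d a) // !bracketE opprB. Qed.

Lemma loc_actNl D x : loc_act (- D) x = - loc_act D x.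
Proof.
have z : loc_act 0 x = 0 by apply: (addrI (loc_act 0 x)); rewrite -loc_actDl !addr0.
by apply: (addrI (loc_act D x)); rewrite -loc_actDl !subrr.
Qed.

Let bracket_formulaC D D' : bracket_formula D D' -> bracket_formula D' D.
Proof. by move=> H x; rewrite bracketC loc_actNl H opprB. Qed.

Let bracket_formula_ext D' : (forall eta, bracket_formula (loc_der f eta) D') ->
  forall D, bracket_formula D D'.
Proof.
move=> H D x; apply/eqP; rewrite -subr_eq0; apply/eqP; move: D.
apply: (@loc_der_eq0 (N 1).+2) => [|eta]; last by rewrite H subrr.
have nx y := @loc_act_twist_nil y.
apply: twist_nilB.
  apply: (@twist_nil_bracket _ _ (fun D => loc_act D x)); last exact: nx.
  by move=> D1 D2; apply: loc_actDl.
apply: twist_nilB; first exact: (twist_nilS (nx _)).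
exact: (twist_nil_act _ (nx _)).
Qed.

Lemma loc_act_bracket D D' x :
  loc_act (bracket D D') x = loc_act D (loc_act D' x) - loc_act D' (loc_act D x).
Proof.
suff: bracket_formula D D' by apply.
(* Antisymmetry allows the extension principle to be applied to each argument in turn. *)
apply: bracket_formula_ext => eta; apply: bracket_formulaC.
apply: bracket_formula_ext => xi y; elim/fracW: y => m k.
(* Writing m / f^k as a scalar times m / 1, the Leibniz rule reduces the identity to elements of M,
   where it is an axiom. *)
rewrite fracE !(loc_act_leibniz, loc_actDr) bracketE -loc_der_bracket !loc_act_loc_der.
rewrite !quot_act_frac0 (AV_bracket actAV) fracDs -fracN.
by module (loc_ring f).
Qed.

Theorem loc_act_AV : AV_module loc_act.
Proof.
split.
- exact: loc_actDl.
- exact: loc_actZl.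
- exact: loc_actDr.
- by move=> c D x; rewrite loc_act_leibniz der_const scale0r add0r.
- exact: loc_act_bracket.
- exact: loc_act_leibniz.
Qed.

Lemma loc_act_finite eta k x : is_finite_sum
  (fun p => rfrac f 1 (k * p.+1) *: Omega_loc act p (f ^+ k) eta x)
  (loc_act (frac_der f eta k) x).
Proof. by rewrite loc_actE; apply: frac_act_finite. Qed.

End LocAction.

Lemma is_finite_sum_inj (V : zmodType) (u : nat -> V) s t :
  is_finite_sum u s -> is_finite_sum u t -> s = t.
Proof.
move=> [n [un ->]] [m [um ->]].
wlog nm : n m un um / (n <= m)%N => [H|].
  by case/orP: (leq_total n m) => h; [apply: H | apply/esym/H].
rewrite (big_ord_widen m (fun p => u p)) // big_mkcond; apply: eq_bigr => i _.
by case: ltnP => // /un.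
Qed.

Lemma loc_inj_injective (A : comNzRingType) (f : A) :
  (forall a b : A, a * b = 0 -> a = 0 \/ b = 0) -> f <> 0 -> injective (loc_inj f).
Proof.
move=> dom f0 a b /(fracP f (a : A^o) 0 (b : A^o) 0)[k].
rewrite addn0 => /eqP; rewrite -subr_eq0 -scalerBr => /eqP/dom[|/eqP]; last first.
  by rewrite subr_eq0 => /eqP.
elim: k => [/eqP|k IH]; first by rewrite oner_eq0.
by rewrite exprS => /dom[/f0 //|/IH].
Qed.

(** The surjectivity behind Der(A_f) = Der(A)_f rests on finite generation: with k the sum of the
    denominator exponents of D on the generators, f^k D maps A into A. *)
Lemma frac_der_surjective (K : pzRingType) (A : comPzRingType)
    (iota : {rmorphism K -> A}) (f : A) n (g : 'I_n -> A)
    (gen : forall S : A -> Prop,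
      (forall x y, S x -> S y -> S (x + y)) -> (forall x y, S x -> S y -> S (x * y)) ->
      (forall c, S (iota c)) -> (forall i, S (g i)) -> forall a, S a) :
  injective (loc_inj f) -> forall D : der (loc_iota iota f),
  exists p : der iota * nat, D = frac_der f p.1 p.2.
Proof.
move=> inj D; have [DD DZ DM] := derP D.
have fracs (s : loc_ring f) : exists p : A * nat, s = rfrac f p.1 p.2.
  by elim/rfracW: s => a j; exists (a, j).
have /choice[p pP] := fun i => fracs (D (loc_inj f (g i))).
pose k := (\sum_i (p i).2)%N.
have clear_denom a : exists b, loc_inj f (f ^+ k) * D (loc_inj f a) = loc_inj f b.
  move: a; apply: gen => [x y [b bP] [c cP]|x y [b bP] [c cP]|c|i].
  - by exists (b + c); rewrite !rmorphD DD mulrDr bP cP.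
  - exists (b * y + x * c); rewrite rmorphD !rmorphM DM mulrDr mulrA bP /=.
    by rewrite [_ * (_ * D _)]mulrCA cP.
  - by exists 0; rewrite (der_const D c) mulr0 rmorph0.
  - exists (f ^+ (k - (p i).2) * (p i).1); rewrite pP.
    have pk : ((p i).2 <= k)%N by rewrite /k (bigD1 i) //= leq_addr.
    rewrite -[in LHS](subnK pk) exprD rmorphM rmorphM -mulrA; congr (_ * _) => /=.
    by rewrite rfracE mulrA [loc_inj _ _ * _]mulrC loc_unit mul1r.
have [d dP] := choice clear_denom.
have d_der : (d : A -> A^o) \in derivation_pred iota.
  apply/asboolP; split=> [a b|c a|a b]; apply: inj.
  - by rewrite rmorphD /= -!dP rmorphD DD mulrDr.
  - by rewrite rmorphM /= -!dP rmorphM (DZ c) mulrCA.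
  - by rewrite rmorphD !rmorphM /= -!dP rmorphM DM mulrDr; congr (_ + _); [exact: mulrA | exact: mulrCA].
exists (Der d_der, k); apply: loc_der_ext => a.
by rewrite /frac_der der_scaleE loc_derE /= -dP mulrA loc_unit mul1r.
Qed.

Lemma Omega_const (K : pzRingType) (A : comPzRingType) (iota : {rmorphism K -> A})
    (M : lmodType A) (act : der iota -> M -> M) (actAV : AV_module act) p c eta m :
  Omega act p.+1 (iota c) eta m = 0.
Proof.
elim: p eta => [|p IH] eta; last by rewrite OmegaS !IH scaler0 subrr.
by rewrite OmegaS !Omega0 (AV_Zl actAV) subrr.
Qed.

(** * Nilpotency over a smooth coordinate ring, and the theorem *)

Section CoordinateRingOmega.
Variables (K : closedFieldType) (charK : [pchar K] =i pred0).
Variables (n : nat) (X : set ('I_n -> K)).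
Hypotheses (X_closed : zariski_closed X) (X_irr : irreducible_set X) (X_smooth : smooth X).
Variables (A : comAlgType K) (phi : {lrmorphism {mpoly K[n]} -> A}).
Hypothesis A_coord : is_coordinate_ring X phi.

(** With b = a - a(x), all derivations kill b, so the ideal (b) is stable. It is proper because b
    vanishes at x; simplicity gives b = 0. *)
Lemma constant_of_der0 a : (forall eta : der (GRing.in_alg A), eta a = 0) ->
  exists c : K, a = GRing.in_alg A c.
Proof.
move=> a0; have [[x Xx] _] := X_irr; have [e eP] := point_eval A_coord Xx.
exists (e a); apply: contrapT => ac; set b := a - GRing.in_alg A (e a).
have eb : e b = 0 by rewrite rmorphB (point_const eP) subrr.
pose I c := exists r, c = r * b.
have Iid : is_ideal I.
  split; first by exists 0; rewrite mul0r.
    by move=> _ _ [r ->] [s ->]; exists (r + s); rewrite mulrDl.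
  by move=> c _ [r ->]; exists (c * r); rewrite mulrA.
have Ider (eta : der (GRing.in_alg A)) c : I c -> I (eta c).
  move=> [r ->]; exists (eta r); have [etaD _ etaM] := derP eta.
  have eta_b : eta b = 0.
    have := etaD b (GRing.in_alg A (e a)).
    by rewrite subrK a0 (der_const eta) addr0 => <-.
  by rewrite etaM eta_b mulr0 addr0.
have [||r r1] := coord_der_simple charK X_closed X_irr X_smooth A_coord Iid Ider (a := b).
- by exists 1; rewrite mul1r.
- by move=> b0; apply: ac; apply/eqP; rewrite -subr_eq0 -/b b0.
have := rmorph1 e; rewrite r1 rmorphM eb mulr0 => /eqP.
by rewrite eq_sym oner_eq0.
Qed.

Lemma coord_Omega_nilpotent (M : lmodType A) (act : der (GRing.in_alg A) -> M -> M)
    (M_AV : AV_module act) (M_fin : finitely_generated M) (f : A) :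
  exists s, forall p eta m, (s < p)%N -> Omega act p f eta m = 0.
Proof.
have [[mu /eqP mu_f]|no] := pselect (exists mu : der (GRing.in_alg A), mu f != 0).
  apply: (Omega_nilpotent _ _ _ M_AV M_fin mu_f).
  - exact: coord_domain A_coord X_irr.
  - move=> k /eqP; rewrite -(rmorph_nat (GRing.in_alg A)) fmorph_eq0.
    by rewrite ((pcharf0P K).1 charK).
  - exact: coord_der_simple A_coord.
have [|c ->] := @constant_of_der0 f.
  by move=> eta; apply: contrapT => /eqP ef; apply: no; exists eta.
by exists 0%N => -[//|p] eta m _; apply: Omega_const.
Qed.

End CoordinateRingOmega.

Theorem theorem4p5 (K : closedFieldType) (charK : [pchar K] =i pred0)
    (n : nat) (X : set ('I_n -> K))
    (X_closed : zariski_closed X) (X_irr : irreducible_set X) (X_smooth : smooth X)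
    (A : comAlgType K) (phi : {lrmorphism {mpoly K[n]} -> A})
    (A_coord : is_coordinate_ring X phi)
    (M : lmodType A) (act : der (GRing.in_alg A) -> M -> M)
    (M_AV : AV_module act) (M_fin : finitely_generated M)
    (f : A) (f_neq0 : f <> 0) :
  finitely_generated (loc f M : lmodType (loc_ring f)) /\
  exists! actf : der (loc_iota (GRing.in_alg A) f) -> loc f M -> loc f M,
    AV_module actf /\
    forall (eta : der (GRing.in_alg A)) (k : nat) (m : loc f M),
      is_finite_sum
        (fun p => rfrac f 1 (k * p.+1) *: Omega_loc act p (f ^+ k) eta m)
        (actf (frac_der f eta k) m).
Proof.
split; first exact: finitely_generated_loc.
have A_dom := coord_domain A_coord X_irr.
have inj := loc_inj_injective A_dom f_neq0.
have surj := frac_der_surjective (coord_gen A_coord) inj.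
have /choice[N NP] := fun k =>
  coord_Omega_nilpotent charK X_closed X_irr X_smooth A_coord M_AV M_fin (f ^+ k).
exists (loc_act act N surj); split.
  split; first exact: (loc_act_AV M_AV NP inj).
  exact: (loc_act_finite M_AV NP inj).
move=> actf [_ actfP]; apply/funext => D; apply/funext => x.
have [[eta k] ->] := surj D.
exact: is_finite_sum_inj (loc_act_finite M_AV NP inj surj eta k x) (actfP eta k x).
Qed.
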